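(* Let $q$ be a prime power and let $m>n\geq 1$ be integers. (i) If a weak egg $\mathcal{E}$ in $\mathrm{PG}(2n+m-1,q)$ is good at an element $E$, then $E$ induces a partial spread which extends to a Desarguesian $(n-1)$-spread of the quotient space $\mathrm{PG}(2n+m-1,q)/E\cong\mathrm{PG}(n+m-1,q)$. (ii) Let $\mathcal{E}$ be a weak egg in $\mathrm{PG}(2n+m-1,q)$ if $q$ is odd, and an egg in $\mathrm{PG}(2n+m-1,q)$ if $q$ is even. If an element $E\in\mathcal{E}$ induces a partial spread which extends to a Desarguesian $(n-1)$-spread of $\mathrm{PG}(2n+m-1,q)/E\cong\mathrm{PG}(n+m-1,q)$, then $\mathcal{E}$ is good at $E$.
   Context: $\mathrm{PG}(r,q)$ is the $r$-dimensional projective space over $\mathbb{F}_q$; dimensions are projective. A weak egg in $\mathrm{PG}(2n+m-1,q)$ is a set of $q^m+1$ $(n-1)$-spaces such that any three of them span a $(3n-1)$-space. A weak egg $\mathcal{E}$ is an egg if each $E\in\mathcal{E}$ is contained in an $(n+m-1)$-space $T_E$ which is skew from every element of $\mathcal{E}$ different from $E$. For $m>n$, a (weak) egg $\mathcal{E}$ is good at $E\in\mathcal{E}$ if every $(3n-1)$-space containing $E$ and at least two other elements of $\mathcal{E}$ contains exactly $q^n+1$ elements of $\mathcal{E}$. A partial spread is a set of mutually disjoint $(n-1)$-spaces. An element $E\in\mathcal{E}$ induces the partial spread $\{\langle E,F\rangle/E : F\in\mathcal{E}\setminus\{E\}\}$ of $(n-1)$-spaces in the quotient space $\mathrm{PG}(2n+m-1,q)/E\cong\mathrm{PG}(n+m-1,q)$.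 Field reduction: viewing $\mathbb{F}_{q^n}^{r}$ as an $rn$-dimensional $\mathbb{F}_q$-vector space, each point of $\mathrm{PG}(r-1,q^n)$ corresponds to an $(n-1)$-space of $\mathrm{PG}(rn-1,q)$; the set of $(n-1)$-spaces corresponding to all points of $\mathrm{PG}(r-1,q^n)$ partitions the points of $\mathrm{PG}(rn-1,q)$, and a spread obtained in this way (up to choice of identification) is called a Desarguesian $(n-1)$-spread. (In particular a Desarguesian $(n-1)$-spread of $\mathrm{PG}(n+m-1,q)$ exists only if $n\mid m$.) A partial spread extends to a Desarguesian spread if all its elements belong to some Desarguesian $(n-1)$-spread. *)

(* Defs.v *)
From HB Require Import structures.
From mathcomp Require Import all_boot all_order all_algebra all_field.
From mathcomp Require Import generic_quotient ring_quotient.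
From mathcomp Require Import finmap.

Set Implicit Arguments.
Unset Strict Implicit.
Unset Printing Implicit Defensive.

Import GRing.Theory.
Local Open Scope ring_scope.

(* Projective subspaces of PG(N-1, q) are the {vspace V} with V an
   N-dimensional vector space over F, #|F| = q: a projective k-space is a
   subspace of vector dimension k + 1, the span of A and B is (A + B)%VS, and A
   and B are disjoint (skew) iff (A :&: B = 0)%VS. *)

Section QuotientSpace.
Import VectorInternalTheory.
Variables (F : fieldType) (V : vectType F) (E : {vspace V}).

(* MathComp quotients V by E only as an additive group; the F-vector space
   structure is added here. *)
Definition qspace := Quotient.quot (pred_of_vspace E).
HB.instance Definition _ := GRing.Zmodule.on qspace.

Definition qpi (v : V) : qspace := \pi_(qspace)%qT v.

Lemma qpiP u v : (qpi u = qpi v) <-> (u - v \in E).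
Proof. by rewrite Quotient.idealrBE; split=> [h|/eqP //]; apply/eqP. Qed.

Lemma qpi_repr x : qpi (repr x) = x.
Proof. exact: reprK. Qed.

Lemma qpiB : {morph qpi : u v / u - v}.
Proof. by move=> u v; rewrite /qpi raddfB. Qed.

Definition qscale (a : F) (x : qspace) : qspace := qpi (a *: repr x).

Lemma qpiZ a v : qpi (a *: v) = qscale a (qpi v).
Proof. by apply/qpiP; rewrite -scalerBr memvZ //; apply/qpiP; rewrite qpi_repr. Qed.

Lemma qpiD : {morph qpi : u v / u + v}.
Proof. by move=> u v; rewrite /qpi raddfD. Qed.

Fact qscaleA a b x : qscale a (qscale b x) = qscale (a * b) x.
Proof. by rewrite -(qpi_repr x) -!qpiZ scalerA. Qed.
Fact qscale1 : left_id 1 qscale.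
Proof. by move=> x; rewrite -(qpi_repr x) -!qpiZ scale1r. Qed.
Fact qscaleDr : right_distributive qscale +%R.
Proof.
by move=> a x y; rewrite -(qpi_repr x) -(qpi_repr y) -!(qpiD, qpiZ) scalerDr.
Qed.
Fact qscaleDl x : {morph qscale^~ x : a b / a + b}.
Proof. by move=> a b; rewrite -(qpi_repr x) -!qpiZ -qpiD scalerDl. Qed.

HB.instance Definition _ :=
  GRing.Zmodule_isLmodule.Build F qspace qscaleA qscale1 qscaleDr qscaleDl.

Fact qpi_is_linear : linear qpi.
Proof. by move=> a u v; rewrite qpiD qpiZ. Qed.
HB.instance Definition _ := GRing.isLinear.Build F V qspace _ qpi qpi_is_linear.

Let U := (E^C)%VS.
Let coordq (x : qspace) : 'rV_(dim (subvs_of U)) :=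
  v2r (vsproj U (daddv_pi U E (repr x))).

Fact qspace_vect_iso : Vector.axiom (dim (subvs_of U)) qspace.
Proof.
have UE0 : (U :&: E = 0)%VS by rewrite capvC capv_compl.
have kerP w : w \in E -> daddv_pi U E w = 0.
  move=> wE; have wUE : w \in (U + E)%VS by rewrite addvC addv_complf memvf.
  have := daddv_pi_add UE0 wUE; rewrite (@daddv_pi_id _ _ E U) ?capv_compl //.
  by move/(canRL (addrK _)); rewrite subrr.
have coordE v : coordq (qpi v) = v2r (vsproj U (daddv_pi U E v)).
  congr (v2r (vsproj U _)); apply/eqP; rewrite -subr_eq0 -linearB /=.
  by rewrite kerP //; apply/qpiP; rewrite qpi_repr.
exists coordq.
  move=> a x y; rewrite -(qpi_repr x) -(qpi_repr y) -linearP !coordE.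
  by rewrite !linearP.
exists (fun r => qpi (vsval (r2v r : subvs_of U))) => [x|r].
  rewrite -[in RHS](qpi_repr x) /coordq v2rK vsprojK ?memv_pi //.
  apply/qpiP; set v := repr x.
  have vUE : v \in (U + E)%VS by rewrite addvC addv_complf memvf.
  by rewrite -{2}(daddv_pi_add UE0 vUE) opprD addrA subrr add0r memvN memv_pi.
by rewrite coordE daddv_pi_id ?subvsP // vsvalK r2vK.
Qed.
HB.instance Definition _ :=
  Lmodule_hasFinDim.Build F qspace qspace_vect_iso.

Definition qmap : 'Hom(V, qspace) := linfun qpi.

Lemma qmapE v : qmap v = qpi v.
Proof. by rewrite lfunE. Qed.

Lemma lker_qmap : lker qmap = E.
Proof.
apply/vspaceP=> v; rewrite memv_ker qmapE -(linear0 qpi) -[v in RHS]subr0.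
by apply/eqP/idP => /qpiP.
Qed.

Lemma limg_qmap : limg qmap = fullv.
Proof.
apply/vspaceP=> x; rewrite memvf -(qpi_repr x) -qmapE.
exact: memv_img (memvf _).
Qed.

End QuotientSpace.

Arguments qspace {F V} E.
Arguments qpi {F V} E v.
Arguments qmap {F V} E.

Section Eggs.
Local Open Scope fset_scope.
Variables (F : finFieldType) (n m : nat).

Section Ambient.
Variable V : vectType F.
Implicit Types (A : {fset {vspace V}}) (E : {vspace V}).

Definition weak_egg A : Prop :=
  [/\ #|` A| = (#|F| ^ m + 1)%N,
      forall E, E \in A -> \dim E = n
    & forall E1 E2 E3, E1 \in A -> E2 \in A -> E3 \in A ->
        E1 != E2 -> E1 != E3 -> E2 != E3 ->
        \dim (E1 + E2 + E3)%VS = (3 * n)%N].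

Definition egg A : Prop :=
  weak_egg A /\
  forall E, E \in A -> exists T : {vspace V},
    [/\ \dim T = (n + m)%N, (E <= T)%VS
      & forall E', E' \in A -> E' != E -> (T :&: E' = 0)%VS].

Definition good_at A E : Prop :=
  forall S : {vspace V}, \dim S = (3 * n)%N -> (E <= S)%VS ->
    (2 <= #|` [fset X in A | (X != E) && (X <= S)%VS]|)%N ->
    #|` [fset X in A | (X <= S)%VS]| = (#|F| ^ n + 1)%N.

Definition partial_spread A : Prop :=
  (forall X, X \in A -> \dim X = n) /\
  (forall X Y, X \in A -> Y \in A -> X != Y -> (X :&: Y = 0)%VS).

Definition induced_family A E : {fset {vspace (qspace E)}} :=
  [fset (qmap E @: (E + X))%VS | X in A `\ E].

(* K plays the role of F_(q^n); psi identifies V with K^r as F-vector spaces: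
   it is F-linear for the scalar action of F on K^r through F -> K.  The
   elements of the spread are the K-points <[u]> of PG(r-1, q^n), transported
   back to V. *)
Definition desarguesian_spread (D : {vspace V} -> Prop) : Prop :=
  exists (K : fieldExtType F) (r : nat)
         (psi : {linear V -> 'rV[K]_r | in_alg K \; *:%R}),
    [/\ \dim {:K} = n, bijective psi
      & forall S : {vspace V}, D S <->
          exists2 u : 'rV[K]_r, u != 0 &
            forall v : V, (v \in S) = (psi v \in <[u]>%VS)].

Definition extends_to_desarguesian A : Prop :=
  exists2 D : {vspace V} -> Prop,
    desarguesian_spread D & forall X, X \in A -> D X.

End Ambient.

Definition induces_desarguesian (V : vectType F) (A : {fset {vspace V}})
    (E : {vspace V}) : Prop :=
  partial_spread (induced_family A E) /\
  extends_to_desarguesian (induced_family A E).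

End Eggs.

(* Main.v *)
From HB Require Import structures.
Require Import Defs.
From mathcomp Require Import all_boot all_order all_algebra all_field.
From mathcomp Require Import finmap zify.

(* Work in the quotient W by E, of dimension n + m, with the q^m pairwise
   disjoint n-spaces P i = <E, X>/E, and call "line" the span of two of them.

   (i) Being good at E means that every line contains exactly q^n of the P i.
   For n = 1 take K = F.  For n > 1, a coset of P i inside a line through P i
   meets every other element of that line in one vector and has one further
   vector; as the vectors of the coset sum to 0, that vector depends linearly
   on the coset.  Hence the holes (vectors on no P i) form a subspace H that
   complements each P i.  Two lines sharing a hole have the same holes, which is
   the parallelism of an affine space.  Fix X = P i0 and a nonzero e in X; the
   P i are the graphs of linear maps X -> H, and for w in H let x |-> x * w be
   the one sending e to w.  Parallelism makes * additive in w and shows that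
   x * (y * w) = z * w for some z that does not depend on w.  So X becomes a
   finite ring without zero divisors, a field K by Wedderburn, and W a
   K-vector space in which each P i is the K-line of e + w for some w in H.

   (ii) A line contains at most q^n of the P i: for an egg, T_E / E takes up an
   n-space of it; for odd q, a line with q^n + 1 of them would give q^n + 2
   elements of the egg in a 3n-space, perfectly matched by any point p on none
   of them via p in <X, Y>, although q^n + 2 is odd.  In a Desarguesian spread
   two lines through P i meet only in P i, so counting the pairs (v, j) with v
   in <P i, P j> outside P i shows that every line has exactly q^n elements. *)

Set Implicit Arguments.
Unset Strict Implicit.
Unset Printing Implicit Defensive.

Import GRing.Theory.
Local Open Scope ring_scope.

(** * Fields from multiplications without zero divisors *)

Lemma finite_domain_mulC (T : finZmodType) (one : T) (mul : T -> T -> T) :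
  associative mul -> left_id one mul -> right_id one mul ->
  left_distributive mul +%R -> right_distributive mul +%R -> one != 0 ->
  (forall x y, mul x y = 0 -> x = 0 \/ y = 0) -> commutative mul.
Proof.
move=> mulA mul1 mulr1 mulDl mulDr one_neq0 mul_eq0.
pose rT := GRing.Zmodule_isNzRing.Build T mulA mul1 mulr1 mulDl mulDr one_neq0.
pose R1 : finNzRingType := HB.pack T rT.
pose R2 : finUnitRingType := HB.pack R1 (FinRing.isNzRing.Build R1).
(* Wedderburn's little theorem, for the ring just packed. *)
apply: (@finDomain_mulrC R2) => x y xy0.
by case: (mul_eq0 x y xy0) => ->; rewrite eqxx ?orbT.
Qed.

Section FieldOfMul.
Variables (F : fieldType) (X : vectType F).

Record field_mul (one : X) (mul : X -> X -> X) : Prop := FieldMul {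
  fmulA : associative mul;
  fmulC : commutative mul;
  fmul1 : left_id one mul;
  fmulDl : left_distributive mul +%R;
  fone_neq0 : one != 0;
  fmulZl : forall a x y, a *: mul x y = mul (a *: x) y;
  fmul_eq0 : forall x y, mul x y = 0 -> x = 0 \/ y = 0
}.

Variables (one : X) (mul : X -> X -> X) (fX : field_mul one mul).

(** A copy of [X] indexed by the proof, so that ring instances built from [one] and [mul] can be
    attached to it. *)
Definition mul_field of field_mul one mul : Type := X.
Local Notation K := (mul_field fX).

HB.instance Definition _ := Vector.on K.
HB.instance Definition _ :=
  GRing.Zmodule_isComNzRing.Build K (fmulA fX) (fmulC fX) (fmul1 fX)
    (fmulDl fX) (fone_neq0 fX).
HB.instance Definition _ := GRing.Lmodule_isLalgebra.Build F K (fmulZl fX).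

Fact mul_field_scaleAr (a : F) (x y : K) : a *: (x * y) = x * (a *: y).
Proof. by rewrite mulrC scalerAl mulrC. Qed.

HB.instance Definition _ := GRing.Lalgebra_isAlgebra.Build F K mul_field_scaleAr.
HB.instance Definition _ := Algebra_isFalgebra.Build F K.

Fact mul_field_domain : GRing.integral_domain_axiom K.
Proof. by move=> x y /(fmul_eq0 fX)[] ->; rewrite eqxx ?orbT. Qed.

HB.instance Definition _ := GRing.ComUnitRing_isIntegral.Build K mul_field_domain.
HB.instance Definition _ :=
  GRing.UnitRing_isField.Build K (Falgebra_FieldMixin mul_field_domain).

End FieldOfMul.

(** * The multipliers [x ** w] as a field acting on [H] *)

Section StarField.
Variables (F : finFieldType) (X H : vectType F) (e : X) (star : X -> H -> H).
Local Notation "x ** w" := (star x w) (at level 40, left associativity).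

Hypothesis starDl : forall x y w, (x + y) ** w = x ** w + y ** w.
Hypothesis starZl : forall a x w, (a *: x) ** w = a *: (x ** w).
Hypothesis starDr : forall x w w', x ** (w + w') = x ** w + x ** w'.
Hypothesis star1 : forall w, e ** w = w.
Hypothesis star_eq0 : forall x w, x ** w = 0 -> x = 0 \/ w = 0.
Hypothesis star_closed : forall x y w, exists z, x ** (y ** w) = z ** w.
Variables (w0 w1 : H).
Hypothesis w0_neq0 : w0 != 0.
Hypothesis w1_notin : forall x, x ** w0 <> w1.

Let star0l w : 0 ** w = 0.
Proof. by rewrite -(scale0r 0) starZl scale0r. Qed.

Let star0r x : x ** 0 = 0.
Proof. by apply: (addrI (x ** 0)); rewrite -starDr !addr0. Qed.

Let starNl x w : (- x) ** w = - (x ** w).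
Proof. by rewrite -scaleN1r starZl scaleN1r. Qed.

Let star_inj w : w != 0 -> injective (star^~ w).
Proof.
move=> nzw x y /= xyw; apply/eqP; rewrite -subr_eq0; apply/eqP.
have /star_eq0[] // : (x - y) ** w = 0 by rewrite starDl starNl xyw subrr.
by move=> w0'; rewrite w0' eqxx in nzw.
Qed.

(* Counting: [y ** w] spans a copy of [X] inside the one spanned by [w]. *)
Let star_line w y : y != 0 -> exists z, z ** (y ** w) = w.
Proof.
move=> nzy; have [->|nzw] := eqVneq w 0; first by exists 0; rewrite !star0r.
have nzyw : y ** w != 0.
  by apply/eqP=> /star_eq0[] E; [move: nzy | move: nzw]; rewrite E eqxx.
have ex x : exists z, x ** (y ** w) == z ** w.
  by have [z ->] := star_closed x y w; exists z.
pose f (x : finvect_type X) : finvect_type X := xchoose (ex x).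
have fP x : x ** (y ** w) = f x ** w by apply/eqP/(xchooseP (ex x)).
have f_inj : injective f.
  by move=> x x' ff; apply: (star_inj nzyw); rewrite /= !fP ff.
by exists (invF f_inj e); rewrite fP f_invF star1.
Qed.

(** The orbits of [w] and [w'] meet only in 0: for [y != 0] some [z] brings [y ** w'] back to [w'],
    which would then lie in the orbit of [w]. *)
Let sep w w' x y : w != 0 -> (forall x, x ** w <> w') ->
  x ** w = y ** w' -> x = 0 /\ y = 0.
Proof.
move=> nzw nww' xy; have [y0|nzy] := eqVneq y 0.
  split=> //; rewrite y0 star0l in xy; case/star_eq0: xy => // w0'.
  by rewrite w0' eqxx in nzw.
have [z zyw] := star_line w' nzy; have [t zxw] := star_closed z x w.
by case: (nww' t); rewrite -zxw xy.
Qed.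

(** Both multipliers are compared with the multiplier [t] of [w + w']: additivity gives
    [(z - t) ** w = (t - z') ** w'], and [sep] makes both sides trivial. *)
Let same_mul x y w w' z z' : w != 0 -> (forall x, x ** w <> w') ->
  x ** (y ** w) = z ** w -> x ** (y ** w') = z' ** w' -> z = z'.
Proof.
move=> nzw nww' zw zw'; have [t] := star_closed x y (w + w').
rewrite !starDr zw zw' => tE.
have : (z - t) ** w = (t - z') ** w'.
  rewrite !starDl !starNl; apply/eqP.
  by rewrite subr_eq addrAC eq_sym subr_eq addrC -tE addrC.
by case/(sep nzw nww') => /eqP + /eqP; rewrite !subr_eq0 => /eqP-> /eqP.
Qed.

Let star_mul_ex x y : exists z, x ** (y ** w0) == z ** w0.
Proof. by have [z ->] := star_closed x y w0; exists z. Qed.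

Let star_mul x y : X := xchoose (star_mul_ex x y).

(** The product read off at [w0] is valid at every [w]. If [w] is off the orbit of [w0], [same_mul]
    compares the two directly; otherwise the comparison passes through [w1], which lies in neither
    orbit. *)
Let star_mulP x y w : x ** (y ** w) = star_mul x y ** w.
Proof.
have mul0 : x ** (y ** w0) = star_mul x y ** w0.
  exact/eqP/(xchooseP (star_mul_ex x y)).
have [->|nzw] := eqVneq w 0; first by rewrite !star0r.
have [z zw] := star_closed x y w; rewrite zw; congr (_ ** _).
have [z1 z1w] := star_closed x y w1.
have -> : star_mul x y = z1 by exact: (same_mul w0_neq0 w1_notin mul0 z1w).
have [/existsP[t /eqP tw]|nw] :=
    boolP [exists t : finvect_type X, t ** w0 == w].
  apply: (same_mul nzw) zw z1w => u uw.
  by have [v vE] := star_closed u t w0; case: (w1_notin (x := v)); rewrite -vE tw.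
have zE : star_mul x y = z.
  apply: (same_mul w0_neq0) mul0 zw => t tw; case/negP: nw.
  by apply/existsP; exists t; rewrite tw.
by rewrite -zE; apply: (same_mul w0_neq0 w1_notin mul0 z1w).
Qed.

Let star_mul_inj x y : (forall w, x ** w = y ** w) -> x = y.
Proof. by move/(_ w0)/(star_inj w0_neq0). Qed.

Let star_mulC : commutative star_mul.
Proof.
apply: (@finite_domain_mulC (finvect_type X) e star_mul).
- by move=> x y z; apply: star_mul_inj => w; rewrite -!star_mulP.
- by move=> x; apply: star_mul_inj => w; rewrite -!star_mulP star1.
- by move=> x; apply: star_mul_inj => w; rewrite -!star_mulP star1.
- by move=> x y z; apply: star_mul_inj => w; rewrite starDl -!star_mulP -starDl.
- by move=> x y z; apply: star_mul_inj => w; rewrite starDl -!star_mulP !starDl starDr.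
- apply/eqP=> e0; have := star1 w0; rewrite e0 star0l => /esym/eqP.
  by rewrite (negPf w0_neq0).
move=> x y xy0; have : x ** (y ** w0) = 0 by rewrite star_mulP xy0 star0l.
case/star_eq0; [by left | case/star_eq0 => [|w00]; first by right].
by case/eqP: w0_neq0.
Qed.

(** Scaling by [a] is multiplication by [a *: e], so homogeneity in [w] follows from the
    commutativity of [star_mul]. *)
Let starZr a x w : x ** (a *: w) = a *: (x ** w).
Proof.
have -> : a *: w = (a *: e) ** w by rewrite starZl star1.
by rewrite star_mulP star_mulC -star_mulP starZl star1.
Qed.

Lemma star_field : exists (K : fieldExtType F) (kappa : {linear K -> X}),
  [/\ bijective kappa, kappa 1 = e,
      forall a b w, kappa (a * b) ** w = kappa a ** (kappa b ** w)
    & forall a x w, x ** (a *: w) = a *: (x ** w)].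
Proof.
have fX : field_mul e star_mul.
  split.
  - by move=> x y z; apply: star_mul_inj => w; rewrite -!star_mulP.
  - exact: star_mulC.
  - by move=> x; apply: star_mul_inj => w; rewrite -!star_mulP star1.
  - by move=> x y z; apply: star_mul_inj => w; rewrite starDl -!star_mulP -starDl.
  - apply/eqP=> e0; have := star1 w0; rewrite e0 star0l => /esym/eqP.
    by rewrite (negPf w0_neq0).
  - by move=> a x y; apply: star_mul_inj => w; rewrite starZl -!star_mulP starZl.
  move=> x y xy0; have : x ** (y ** w0) = 0 by rewrite star_mulP xy0 star0l.
  case/star_eq0; [by left | case/star_eq0 => [|w00]; first by right].
  by case/eqP: w0_neq0.
exists (mul_field fX), (idfun : {linear X -> X}); split=> //=.
by exists id.
Qed.

End StarField.

(** * Coordinates over a field [K] acting on an [F]-space *)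

Section ActionCoordinates.
Variables (F : fieldType) (K : fieldExtType F) (W : vectType F).
Variable act : K -> W -> W.
Hypothesis actDl : forall a b w, act (a + b) w = act a w + act b w.
Hypothesis actDr : forall a v w, act a (v + w) = act a v + act a w.
Hypothesis actZr : forall k a w, act a (k *: w) = k *: act a w.
Hypothesis actA : forall a b w, act (a * b) w = act a (act b w).
Hypothesis actF : forall k w, act (k%:A) w = k *: w.

Let act1 w : act 1 w = w. Proof. by rewrite -(scale1r 1) actF scale1r. Qed.

Let actZl k a w : act (k *: a) w = k *: act a w.
Proof. by rewrite -actF -actA mulr_algl. Qed.

Let act0 w : act 0 w = 0. Proof. by rewrite -(scale0r 1) actF scale0r. Qed.

Let actNl a w : act (- a) w = - act a w.
Proof. by rewrite -scaleN1r actZl scaleN1r. Qed.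

Let actNr a w : act a (- w) = - act a w.
Proof. by rewrite -scaleN1r actZr scaleN1r. Qed.

Let act_sum a r (f : 'I_r -> W) :
  act a (\sum_i f i) = \sum_i act a (f i).
Proof.
apply: (big_morph (act a) (actDr a)).
by have := actZr 0 a 0; rewrite !scale0r.
Qed.

Let orbit_fun w (a : K) : W := act a w.
Let orbit_linear w : linear (orbit_fun w).
Proof. by move=> k a b; rewrite /orbit_fun actDl actZl. Qed.
HB.instance Definition _ w :=
  GRing.isLinear.Build F K W _ (orbit_fun w) (orbit_linear w).

Let line w : {vspace W} := limg (linfun (orbit_fun w)).

Let lineP v w : reflect (exists a, v = act a w) (v \in line w).
Proof.
apply: (iffP memv_imgP) => [[a _ ->]|[a ->]]; exists a; rewrite ?memvf //.
  by rewrite lfunE.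
by rewrite lfunE.
Qed.

Let comb r (ws : 'I_r -> W) (a : 'rV[K]_r) := \sum_i act (a 0 i) (ws i).

Let combB r (ws : 'I_r -> W) a b : comb ws (a - b) = comb ws a - comb ws b.
Proof.
rewrite /comb -sumrB; apply: eq_bigr => i _.
by rewrite !mxE actDl actNl.
Qed.

Let combD r (ws : 'I_r -> W) a b : comb ws (a + b) = comb ws a + comb ws b.
Proof. by rewrite /comb -big_split; apply: eq_bigr => i _; rewrite mxE actDl. Qed.

Let combZ r (ws : 'I_r -> W) k a : comb ws (k *: a) = act k (comb ws a).
Proof.
by rewrite /comb act_sum; apply: eq_bigr => i _; rewrite mxE actA.
Qed.

Let comb_span r (ws : 'I_r -> W) v :
  v \in (\sum_i line (ws i))%VS -> exists a, comb ws a = v.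
Proof.
case/memv_sumP=> vs vsP ->.
have ex i : exists a, vs i == act a (ws i).
  by have [//|a ->] := lineP _ _ (vsP i _); exists a.
exists (\row_i xchoose (ex i)); apply: eq_bigr => i _.
by rewrite mxE; apply/esym/eqP/(xchooseP (ex i)).
Qed.

(** Induction on a bound [d] for the [F]-codimension of the span. Adding a vector [v] outside the
    span keeps the family free over [K], since a nonzero coefficient of [v] in a relation could be
    inverted. *)
Let basis_extend d r (ws : 'I_r -> W) :
  (\dim {:W} - \dim (\sum_i line (ws i)) <= d)%N ->
  (forall a, comb ws a = 0 -> a = 0) ->
  exists r' (ws' : 'I_r' -> W),
    (forall a, comb ws' a = 0 -> a = 0) /\
    (\sum_i line (ws' i) = fullv)%VS.
Proof.
elim: d r ws => [|d IHd] r ws dimU freews.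
  exists r, ws; split=> //; apply/eqP; rewrite eqEdim subvf /=.
  by rewrite leqn0 subn_eq0 in dimU.
have [Uf|nUf] := eqVneq (\sum_i line (ws i))%VS fullv; first by exists r, ws.
have [v vU] : exists v, v \notin (\sum_i line (ws i))%VS.
  have : ~~ (fullv <= \sum_i line (ws i))%VS.
    by apply: contra nUf => fU; rewrite eqEsubv subvf.
  by case/subvPn => v _; exists v.
pose ws' (i : 'I_(r + 1)) := match split i with inl j => ws j | inr _ => v end.
have wsl i : ws' (lshift 1 i) = ws i by rewrite /ws' (unsplitK (inl i)).
have wsr i : ws' (rshift r i) = v by rewrite /ws' (unsplitK (inr i)).
have combE a : comb ws' a = comb ws (lsubmx a) + act (rsubmx a 0 0) v.
  rewrite /comb big_split_ord /= big_ord1 wsr !mxE; congr (_ + _).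
  by apply: eq_bigr => i _; rewrite wsl !mxE.
have UE : (\sum_i line (ws' i) = \sum_i line (ws i) + line v)%VS.
  rewrite big_split_ord /= big_ord1 wsr; congr (_ + _)%VS.
  by apply: eq_bigr => i _; rewrite wsl.
have vline : v \in line v by apply/lineP; exists 1; rewrite act1.
apply: (IHd _ ws').
  rewrite UE leq_subLR; rewrite leq_subLR addnS in dimU.
  apply: (leq_trans dimU); rewrite -addSn leq_add2r.
  rewrite ltn_neqAle dimvS ?addvSl // andbT; apply: contra vU => /eqP dE.
  have /eqP-> : (\sum_i line (ws i) == \sum_i line (ws i) + line v)%VS.
    by rewrite eqEdim addvSl dE leqnn.
  by rewrite (subvP (addvSr _ _)).
move=> a; rewrite combE => /eqP; rewrite addr_eq0 => /eqP aE.
have r0 : rsubmx a 0 0 = 0.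
  apply/eqP/negPn/negP=> nz; case/negP: vU.
  have -> : v = comb ws (- (rsubmx a 0 0)^-1 *: lsubmx a).
    by rewrite combZ aE actNl actNr opprK -actA mulVf ?act1.
  apply: memv_sumr => i _; apply/lineP.
  by eexists.
rewrite r0 act0 oppr0 in aE.
rewrite -[a]hsubmxK (freews _ aE) -[RHS]row_mx0; congr row_mx.
by apply/rowP=> i; rewrite !ord1 r0 mxE.
Qed.

(** [psi] is the inverse of [comb] for a [K]-basis grown from the empty family. *)
Lemma action_coordinates :
  exists r (psi : {linear W -> 'rV[K]_r | in_alg K \; *:%R}),
  bijective psi /\ forall a w, psi (act a w) = a *: psi w.
Proof.
have [|r [ws [free full]]] := @basis_extend (\dim {:W}) 0 (fun=> 0) (leq_subr _ _).
  by move=> a _; apply/rowP; case.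
have ex w : exists a, comb ws a == w.
  have [|a <-] := @comb_span _ ws w; first by rewrite full memvf.
  by exists a.
pose psi w := xchoose (ex w).
have psiK w : comb ws (psi w) = w by apply/eqP/(xchooseP (ex w)).
have comb_inj : injective (comb ws).
  move=> a b ab; apply/eqP; rewrite -subr_eq0; apply/eqP/free.
  by rewrite combB ab subrr.
have psi_act a w : psi (act a w) = a *: psi w.
  by apply: comb_inj; rewrite combZ !psiK.
have psi_lin : linear_for (in_alg K \; *:%R) psi.
  move=> k v w /=; apply: comb_inj; rewrite psiK.
  by rewrite combD combZ actF !psiK.
pose psi_mixin := GRing.isLinear.Build F W 'rV[K]_r _ psi psi_lin.
pose psiL : {linear W -> 'rV[K]_r | in_alg K \; *:%R} := HB.pack psi psi_mixin.
exists r, psiL; split=> //; exists (comb ws) => // a.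
by apply: comb_inj; rewrite psiK.
Qed.

End ActionCoordinates.

(** * Double counting and cardinalities of subspaces *)

Lemma double_count (T I : finType) (D : {set T}) (J : {set I}) (B : I -> {set T})
    (b c : nat) :
  (forall j, j \in J -> B j \subset D) -> (forall j, j \in J -> #|B j| = b) ->
  (forall v, v \in D -> (#|[set j in J | v \in B j]| <= c)%N) ->
  (#|J| * b <= #|D| * c)%N /\
  ((#|J| * b = #|D| * c)%N ->
    forall v, v \in D -> #|[set j in J | v \in B j]| = c).
Proof.
move=> sBD cardB le_c.
have sumE : (#|J| * b = \sum_(v in D) #|[set j in J | v \in B j]|)%N.
  rewrite -sum_nat_const (eq_bigr (fun j => \sum_(v in D | v \in B j) 1)%N).
    rewrite (exchange_big_dep (mem D)) /=; last by move=> ? ? ? /andP[].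
    apply: eq_bigr => v vD; rewrite sum1_card -cardsE; apply: eq_card => j.
    by rewrite !inE vD.
  move=> j jJ; rewrite -(cardB j jJ) sum1_card; apply: eq_card => v.
  rewrite [RHS]inE andb_idl // => vB; exact: (subsetP (sBD j jJ)).
(* A sum of termwise bounds is attained only if every term attains its bound. *)
have le_sum := leqif_sum (fun v vD => leqif_eq (le_c v vD)).
rewrite sumE -sum_nat_const; split=> [|/eqP]; first by rewrite le_sum.
by rewrite le_sum => /forall_inP eqc v vD; apply/eqP/eqc.
Qed.

Section VectorSets.
Variables (F : finFieldType) (W : vectType F).
Implicit Types U : {vspace W}.

(** [finvect_type W] makes the vectors a finite type, so that subspaces become finite sets that can
    be counted. *)
Definition vset U : {set finvect_type W} :=
  [set v : finvect_type W | (v : W) \in U].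

Lemma in_vset U v : (v \in vset U) = (v \in U).
Proof. by rewrite inE. Qed.

Lemma card_vset U : #|vset U| = (#|F| ^ \dim U)%N.
Proof.
rewrite cardsE; case: W U => T cT U.
exact: (@card_vspace F (finvect_type (Vector.Pack cT)) cT U).
Qed.

Lemma vset_sub U U' : (U <= U')%VS -> vset U \subset vset U'.
Proof. by move/subvP=> UU'; apply/subsetP=> v; rewrite !in_vset; apply: UU'. Qed.

Lemma card_vsetD U U' : (U <= U')%VS ->
  #|vset U' :\: vset U| = (#|F| ^ \dim U' - #|F| ^ \dim U)%N.
Proof.
by move=> UU'; rewrite cardsD (setIidPr (vset_sub UU')) !card_vset.
Qed.

End VectorSets.

(** * Partial spreads: how many elements a line can contain *)

Section PartialSpread.
Variables (F : finFieldType) (W : vectType F) (I : finType).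
Variables (P : I -> {vspace W}) (n : nat).
Local Notation q := #|F|.
Hypothesis n_gt0 : (0 < n)%N.
Hypothesis dimP : forall i, \dim (P i) = n.
Hypothesis disjP : forall i j, i != j -> (P i :&: P j = 0)%VS.

Lemma qn_gt1 : (1 < q ^ n)%N.
Proof. by rewrite -(exp1n n) ltn_exp2r // finNzRing_gt1. Qed.

Lemma disj_eq i j v : v \in P i -> v \in P j -> v != 0 -> i = j.
Proof.
move=> vi vj nzv; apply/eqP/negPn/negP => /disjP ij0.
by case/negP: nzv; rewrite -memv0 -ij0 memv_cap vi.
Qed.

Lemma dim_line i j : i != j -> \dim (P i + P j) = (n + n)%N.
Proof. by move=> ij; rewrite dimv_disjoint_sum ?disjP // !dimP. Qed.

(** The nonzero vectors of the [P j] form disjoint sets of size [q ^ n - 1] in [U] minus [T], which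
    has at most [q ^ n * (q ^ n - 1)] vectors. *)
Lemma spread_size_skew U T (J : {set I}) : \dim U = (n + n)%N ->
  (n <= \dim (U :&: T))%N -> (forall j, (P j :&: T = 0)%VS) ->
  (forall j, j \in J -> (P j <= U)%VS) -> (#|J| <= q ^ n)%N.
Proof.
move=> dimU dimT PT PU.
have [] := @double_count _ _ (vset U :\: vset (U :&: T)) J
  (fun j => vset (P j) :\: vset 0) (q ^ n - 1) 1.
- move=> j /PU PjU; apply/subsetP=> v; rewrite !inE memv_cap => /andP[nzv vj].
  rewrite (subvP PjU) // andbT; apply: contraNN nzv => vT.
  by rewrite -(PT j) memv_cap vj.
- by move=> j _; rewrite card_vsetD ?sub0v // dimP dimv0.
- move=> v _; apply/card_le1P => j; rewrite !inE => /andP[jJ /andP[nzv vj]] k.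
  rewrite !inE; apply/idP/eqP=> [/and3P[_ _ vk]|->].
    by apply: disj_eq vk vj _; rewrite -memv0.
  by rewrite jJ nzv vj.
rewrite card_vsetD ?capvSl // dimU muln1 => le_J _.
rewrite -(leq_pmul2r (m := q ^ n - 1)) ?subn_gt0 ?qn_gt1 //.
apply: (leq_trans le_J); rewrite mulnBr muln1 -expnD.
by apply: leq_sub2l; rewrite leq_exp2l ?finNzRing_gt1.
Qed.

Section Pencil.
Variables (m : nat) (i : I).
Hypothesis dimW : \dim {:W} = (n + m)%N.
Hypothesis cardI : #|I| = (q ^ m)%N.
Hypothesis line_meet : forall j k v, j != i -> k != i ->
  v \in (P i + P j)%VS -> v \in (P i + P k)%VS -> v \notin P i ->
  (P i + P j = P i + P k)%VS.
Hypothesis line_le : forall j, j != i ->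
  (#|[set k | (P k <= P i + P j)%VS]| <= q ^ n)%N.

(** All [j] counted for one [v] lie on a single line through [P i], so [line_le] bounds their number
    by [q ^ n - 1], the element [i] itself being left out. The total number of pairs attains this
    bound, hence so does every [v]. *)
Lemma pencil_count v : v \notin P i ->
  #|[set j in [set~ i] | v \in (P i + P j)%VS]| = (q ^ n - 1)%N.
Proof.
move=> vi; pose v' : finvect_type W := v.
suff <- : #|[set j in [set~ i] | v' \in vset (P i + P j) :\: vset (P i)]|
            = (q ^ n - 1)%N.
  by apply: eq_card => j; rewrite !inE vi.
have := @double_count _ _ (vset fullv :\: vset (P i)) [set~ i]
  (fun j => vset (P i + P j) :\: vset (P i)) (q ^ (n + n) - q ^ n) (q ^ n - 1).
case.
- by move=> j _; rewrite setSD // vset_sub // subvf.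
- move=> j; rewrite !inE => ji.
  by rewrite card_vsetD ?addvSl // dim_line 1?eq_sym // dimP.
- move=> u _; set S := [set j in _ | _].
  have [->|[j]] := set_0Vmem S; first by rewrite cards0.
  rewrite !inE => /and3P[ji ui uj].
  have := line_le ji; rewrite (cardsD1 i) inE addvSl add1n => lej.
  rewrite leq_subRL ?(ltnW qn_gt1) // add1n.
  apply: leq_trans lej; rewrite ltnS; apply/subset_leq_card/subsetP => k.
  rewrite !inE => /and3P[ki _ uk]; rewrite ki /=.
  by rewrite (line_meet ji ki uj uk ui) addvSr.
move=> _; apply; last by rewrite !inE /v' vi memvf.
(* Both totals equal [q ^ n * (q ^ m - 1) * (q ^ n - 1)]. *)
rewrite cardsC1 cardI card_vsetD ?subvf // dimW dimP !expnD.
rewrite -[X in (_ * (_ - X))%N]muln1 -mulnBr.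
by rewrite -[X in (_ = (_ - X) * _)%N]muln1 -mulnBr -subn1 mulnCA mulnA.
Qed.

Lemma pencil_cover v : v \notin P i -> exists2 j, j != i & v \in (P i + P j)%VS.
Proof.
move=> /pencil_count cS; have := qn_gt1; rewrite -subn_gt0 -cS.
by case/card_gt0P=> j; rewrite !inE => /andP[ji vj]; exists j.
Qed.

(** For a nonzero [v] in [P j], the [q ^ n - 1] indices given by [pencil_count] all lie on the line
    [P i + P j]; [i] is one more. *)
Lemma pencil_line j : j != i -> #|[set k | (P k <= P i + P j)%VS]| = (q ^ n)%N.
Proof.
move=> ji; apply/eqP; rewrite eqn_leq line_le //=.
have [v vj nzv] : exists2 v, v \in P j & v != 0.
  exists (vpick (P j)); first exact: memv_pick.
  by rewrite vpick0 -dimv_eq0 dimP -lt0n.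
have vi : v \notin P i.
  by apply: contraNN ji => vi; rewrite (disj_eq vj vi nzv).
rewrite (cardsD1 i) inE addvSl -(subnKC (ltnW qn_gt1)) leq_add2l.
rewrite -(pencil_count vi); apply/subset_leq_card/subsetP => k.
rewrite !inE => /andP[ki vk]; rewrite ki /=.
by rewrite (@line_meet j k v) ?addvSr // (subvP (addvSr _ _)).
Qed.

End Pencil.
End PartialSpread.

(** * Vanishing sums and projections *)

Lemma sum_vset (F : finFieldType) (W : vectType F) (U : {vspace W}) :
  (1 < \dim U)%N -> \sum_(x in vset U) (x : W) = 0.
Proof.
set s := \sum_(x in _) _ => dimU.
have sU : s \in U by apply: memv_suml => x; rewrite in_vset.
rewrite (coord_vbasis sU); apply: big1 => k _.
have [l lk] : exists l : 'I_(\dim U), l != k.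
  apply/existsP; rewrite -[X in is_true X]negbK negb_exists.
  apply/negP=> /forallP all_k; have := dimU; rewrite -[X in (_ < X)%N]card_ord.
  rewrite (cardD1 k) (@eq_card0 _ [predD1 _ & k]) // => l.
  by rewrite !inE; have := all_k l; rewrite negbK => /eqP->; rewrite eqxx.
pose c x := coord (vbasis U) k x.
pose b := (vbasis U)`_l.
have freeU := basis_free (vbasisP U).
have cb : c b = 0 by rewrite /c coord_free // (negPf lk).
have bU : b \in U by apply/vbasis_mem/mem_nth; rewrite size_tuple.
(* A transvection along another basis vector [b], available since the dimension exceeds 1. It
   permutes [U] and fixes the coordinate [c], so summing gives [s = s + c s *: b], whence
   [c s = 0]. *)
pose f (x : finvect_type W) : finvect_type W := (x : W) + c x *: b.
have cf (x : W) : c (f x) = c x.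
  by rewrite /f /c linearD linearZ /= -/(c b) cb mulr0 addr0.
have f_inj : injective f.
  by move=> x y fxy; have := fxy; rewrite /f -(cf x) fxy cf; apply: addIr.
have fU x : (f x \in vset U) = (x \in vset U).
  have fxE : (f x : W) = (x : W) + c x *: b by [].
  rewrite !in_vset; apply/idP/idP=> [fxU|xU].
    by rewrite -[x : W](addrK (c x *: b)) -fxE; apply: memvB fxU (memvZ _ bU).
  by rewrite fxE; apply: memvD xU (memvZ _ bU).
have : s = s + c s *: b.
  rewrite {1}/s (reindex_inj f_inj) /= (eq_bigl _ _ fU) big_split /=.
  congr (_ + _); rewrite -scaler_suml; congr (_ *: _).
  by rewrite /c linear_sum.
move/eqP; rewrite -subr_eq0 opprD addNKr oppr_eq0 scaler_eq0.
case/orP=> [/eqP cs0|b0]; first by rewrite -/(c s) cs0 scale0r.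
have := coord_free l l freeU; rewrite -/b (eqP b0) linear0 eqxx => /esym/eqP.
by rewrite oner_eq0.
Qed.

Lemma mulrn_card_exp (F : finFieldType) (W : lmodType F) (v : W) n :
  (0 < n)%N -> v *+ (#|F| ^ n) = 0.
Proof.
move=> n_gt0; have F0 : (#|F|)%:R = 0 :> F.
  (* Shifting by 1 permutes the field and adds [#|F|] ones to the sum. *)
  have : \sum_(a : F) a = \sum_(a : F) (a + 1).
    by rewrite [LHS](reindex_inj (addIr 1)).
  rewrite big_split /= sumr_const => /eqP.
  by rewrite -subr_eq0 opprD addNKr oppr_eq0 => /eqP.
by rewrite -scaler_nat natrX F0 expr0n gtn_eqF // scale0r.
Qed.

Lemma daddv_piD (F : fieldType) (W : vectType F) (U V : {vspace W}) a b :
  (U :&: V = 0)%VS -> a \in U -> b \in V -> daddv_pi U V (a + b) = a.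
Proof.
move=> UV aU bV; rewrite linearD /= daddv_pi_id //.
have VU : (V :&: U = 0)%VS by rewrite capvC.
have := daddv_pi_add UV (subvP (addvSr U V) _ bV).
by rewrite (daddv_pi_id VU bV) => /(canRL (addrK _)) ->; rewrite subrr addr0.
Qed.

(** * Holes, when every line contains exactly [q ^ n] elements *)

Section Holes.
Variables (F : finFieldType) (W : vectType F) (I : finType).
Variables (P : I -> {vspace W}) (n m : nat).
Local Notation q := #|F|.
Hypothesis n_gt1 : (1 < n)%N.
Hypothesis dimP : forall i, \dim (P i) = n.
Hypothesis disjP : forall i j, i != j -> (P i :&: P j = 0)%VS.
Hypothesis dimW : \dim {:W} = (n + m)%N.
Hypothesis cardI : #|I| = (q ^ m)%N.
Hypothesis lineI : forall i j, i != j ->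
  #|[set k | (P k <= P i + P j)%VS]| = (q ^ n)%N.

Let n_gt0 : (0 < n)%N := ltnW n_gt1.
Let q_gt1 : (1 < q)%N := finNzRing_gt1 F.

Let inj i j v (iv : v \in P i) (jv : v \in P j) (nzv : v != 0) : i = j :=
  disj_eq disjP iv jv nzv.

Let dimL i j (ij : i != j) : \dim (P i + P j) = (n + n)%N :=
  dim_line dimP disjP ij.

Let qn_gt2 : (2 < q ^ n)%N.
Proof.
apply: (@leq_trans (q ^ 2)); last by rewrite leq_exp2l.
by apply: (@leq_trans (2 ^ 2)); last by rewrite leq_exp2r.
Qed.

Lemma nz_in i : exists2 v, v \in P i & v != 0.
Proof.
exists (vpick (P i)); first exact: memv_pick.
by rewrite vpick0 -dimv_eq0 dimP -lt0n.
Qed.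

Lemma line_eq (T : {vspace W}) i j : \dim T = (n + n)%N -> i != j ->
  (P i <= T)%VS -> (P j <= T)%VS -> (P i + P j = T)%VS.
Proof.
move=> dimT ij iT jT; apply/eqP; rewrite eqEdim subv_add iT jT /=.
by rewrite dimT dimL.
Qed.

Lemma third_on_line i j : i != j ->
  exists k, [/\ k != i, k != j & (P k <= P i + P j)%VS].
Proof.
move=> ij; set S := [set k | (P k <= P i + P j)%VS].
have : (0 < #|S :\ i :\ j|)%N.
  rewrite -(ltn_add2l 2) addn0 (leq_trans qn_gt2) // -(lineI ij) -/S.
  rewrite (cardsD1 i S) (cardsD1 j (S :\ i)) addnA leq_add2r.
  by rewrite (leq_add (leq_b1 _) (leq_b1 _)).
by case/card_gt0P=> k; rewrite !inE => /and3P[kj ki kS]; exists k.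
Qed.

(** The zero vector counts as a hole, so that holes can form a subspace. *)
Definition hole_in (T : {vspace W}) v :=
  forall k, (P k <= T)%VS -> v \in P k -> v = 0.

(* [eta i j v] turns out to be the only hole of the line [P i + P j] in the
   coset [v + P i]: the other vectors of that coset are its intersections
   with the elements [P k] of the line, and the whole coset sums to 0. *)
Definition eta i j v : W :=
  - \sum_(k | (k != i) && (P k <= P i + P j)%VS) daddv_pi (P k) (P i) v.

Lemma etaD i j u v : eta i j (u + v) = eta i j u + eta i j v.
Proof.
rewrite /eta -opprD -big_split; congr (- _).
by apply: eq_bigr => k _; rewrite linearD.
Qed.

Section OneLine.
Variables i j : I.
Hypothesis ij : i != j.
Local Notation T := (P i + P j)%VS.
Local Notation p k := (daddv_pi (P k) (P i)).

Let pE k v : k != i -> (P k <= T)%VS -> v \in T ->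
  p k v \in P k /\ v - p k v \in P i.
Proof.
move=> ki kT vT; split; first exact: memv_pi.
have kiT : (P k + P i = T)%VS by apply: line_eq; rewrite ?dimL ?addvSl.
have vki : v \in (P k + P i)%VS by rewrite kiT.
by rewrite -{1}(daddv_pi_add (disjP ki) vki) addrC addKr memv_pi.
Qed.

Let p_uniq k v u : k != i -> u \in P k -> v - u \in P i -> p k v = u.
Proof.
by move=> ki uk vui; rewrite -[v](subrKC u) daddv_piD ?disjP.
Qed.

Lemma eta_in v : v \in P i -> eta i j v = 0.
Proof.
move=> vi; rewrite /eta big1 ?oppr0 // => k /andP[ki _].
by apply: p_uniq; rewrite ?mem0v ?subr0.
Qed.

Lemma eta_coset v : v \in T -> v \notin P i ->
  [/\ v - eta i j v \in P i, hole_in T (eta i j v)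
    & hole_in T v -> eta i j v = v].
Proof.
move=> vT vi.
pose C : {set finvect_type W} := [set u : finvect_type W | v - (u : W) \in P i].
pose K := [set k | (k != i) && (P k <= T)%VS].
pose pv k : finvect_type W := p k v.
have inC u : (u \in C) = (v - (u : W) \in P i) by rewrite inE.
have KP k : k \in K -> k != i /\ (P k <= T)%VS by rewrite inE => /andP.
have pvK k : k \in K -> (pv k : W) \in P k /\ v - (pv k : W) \in P i.
  by case/KP=> ki kT; apply: pE.
have BC : pv @: K \subset C.
  by apply/subsetP=> _ /imsetP[k kK ->]; rewrite inC; case: (pvK k kK).
have pv_inj : {in K &, injective pv}.
  move=> k l kK lK kl; have [vk vki] := pvK k kK; have [vl _] := pvK l lK.
  rewrite -kl in vl; apply: inj vk vl _; apply: contraNneq vi => v0.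
  by rewrite v0 subr0 in vki.
pose shift (x : finvect_type W) : finvect_type W := v - (x : W).
have shift_inj : injective shift.
  by move=> x y /(congr1 (fun z : W => v - z)); rewrite !subKr.
have CE : C = [set shift x | x in vset (P i)].
  apply/setP=> u; rewrite inC; apply/idP/imsetP=> [ui|[x]].
    exists (shift u); first by rewrite in_vset.
    by rewrite /shift; apply/esym; apply: (@subKr W).
  by rewrite in_vset => xi ->; rewrite /shift (@subKr W).
have cardC : #|C| = (q ^ n)%N by rewrite CE card_imset // card_vset dimP.
have cardB : (#|pv @: K| + 1)%N = (q ^ n)%N.
  rewrite card_in_imset // -(lineI ij) [in RHS](cardsD1 i) inE addvSl addn1 add1n.
  by congr _.+1; apply: eq_card => k; rewrite !inE.
(* The [q ^ n - 1] elements of the line other than [P i] meet the coset [C] in distinct vectors, so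
   exactly one vector [w] of [C] is left over. *)
have /cards1P[w wE] : #|C :\: pv @: K| == 1%N.
  by rewrite cardsD (setIidPr BC) cardC -cardB addKn.
(* The coset consists of the [v - x] with [x] in [P i]: the [q ^ n] copies of [v] cancel by the
   characteristic, the [x] by [sum_vset]. *)
have sumC : \sum_(u in C) (u : W) = 0.
  rewrite CE (big_imset _ (in2W shift_inj)) /= sumrB sum_vset ?dimP // subr0.
  by rewrite sumr_const card_vset dimP (mulrn_card_exp (W := W)).
have etaE : eta i j v = w.
  have : \sum_(u in C) (u : W) = (w : W) - eta i j v.
    rewrite (big_setID (pv @: K)) /= (setIidPr BC) wE big_set1 addrC.
    congr (_ + _); rewrite /eta opprK (big_imset _ pv_inj) /=.
    by apply: eq_bigl => k; rewrite inE.
  by rewrite sumC => /eqP; rewrite eq_sym subr_eq0 eq_sym => /eqP.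
have : w \in C :\: pv @: K by rewrite wE set11.
rewrite etaE in_setD inC => /andP[wB wi]; split=> //.
  move=> k kT wk; apply/eqP/negPn/negP => nzw.
  have [ki|ki] := eqVneq k i.
    by case/negP: vi; rewrite -[v](subrK (w : W)) memvD // -ki.
  case/imsetP: wB; exists k; first by rewrite inE ki.
  by rewrite /pv (p_uniq ki wk wi).
(* If [v] is itself a hole, it is the leftover vector of its own coset. *)
move=> hv; suff : (v : finvect_type W) \in C :\: pv @: K.
  by rewrite wE inE => /eqP.
rewrite in_setD inC subrr mem0v andbT; apply/imsetP=> -[k kK vk].
have [vk' _] := pvK k kK; rewrite -vk in vk'.
have [_ kT] := KP k kK; case/negP: vi.
by rewrite (hv k kT vk') mem0v.
Qed.

(** The holes of a line are the vectors of that line fixed by the additive map [eta i j]. *)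
Lemma hole_inD u v : u \in T -> v \in T -> hole_in T u -> hole_in T v ->
  hole_in T (u + v).
Proof.
have etaK w : w \in T -> hole_in T w -> eta i j w = w.
  move=> wT hw; have [wi|wi] := boolP (w \in P i).
    by rewrite (hw i (addvSl _ _) wi) eta_in ?mem0v.
  by case: (eta_coset wT wi) => _ _; apply.
move=> uT vT hu hv; have E : eta i j (u + v) = u + v by rewrite etaD !etaK.
have [uvi|uvi] := boolP (u + v \in P i).
  by rewrite -E eta_in // => k.
have [_ + _] := eta_coset (memvD uT vT) uvi.
by rewrite E.
Qed.

End OneLine.

(** If the lines differ, [P j] and a third element [P l] of its line are off [P i + P k]. Modulo
    [P i], [v] agrees with some [y] in [P j] and some [y'] in [P l], both holes of [P i + P k]. Then
    [y - y'] is a hole in [P i], so [y = y' = 0] and [v] is in [P i]. *)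
Lemma line_meet i j k v : j != i -> k != i -> v \in (P i + P j)%VS ->
  v \in (P i + P k)%VS -> v \notin P i -> (P i + P j = P i + P k)%VS.
Proof.
move=> ji ki vj vk vi; have ij : i != j by rewrite eq_sym.
have ik : i != k by rewrite eq_sym.
have dimk := dimL ik.
have [l [li lj lT]] := third_on_line ij.
have jlT : (P i + P l = P i + P j)%VS.
  by apply: line_eq; rewrite ?dimL ?addvSl // eq_sym.
have [jk|njk] := boolP (P j <= P i + P k)%VS.
  by apply: line_eq => //; rewrite addvSl.
have nlk : ~~ (P l <= P i + P k)%VS.
  apply: contra njk => lk; have <- : (P i + P l = P i + P k)%VS.
    by apply: line_eq; rewrite ?addvSl // eq_sym.
  by rewrite jlT addvSr.
have split_v s : ~~ (P s <= P i + P k)%VS -> v \in (P i + P s)%VS ->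
  exists x y, [/\ x \in P i, y \in P s, v = x + y, y \in (P i + P k)%VS
     & hole_in (P i + P k) y].
  move=> nsk /memv_addP[x xi [y ys vE]]; exists x, y; split=> //.
    by rewrite -(addKr x y) -vE memvD ?memvN // (subvP (addvSl _ _)).
  move=> t tT yt; apply/eqP/negPn/negP => nzy.
  by case/negP: nsk; rewrite (inj ys yt nzy).
have [x [y [xi yj vE yT hy]]] := split_v _ njk vj.
have vl : v \in (P i + P l)%VS by rewrite jlT.
have [x' [y' [xi' yl vE' yT' hy']]] := split_v _ nlk vl.
have hyN : hole_in (P i + P k) (- y').
  by move=> t tT; rewrite memvN => /(hy' t tT) ->; rewrite oppr0.
have yy' : y + - y' = 0.
  apply: (hole_inD ik yT _ hy hyN (addvSl _ _)); first by rewrite memvN.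
  rewrite -(addKr x y) -vE vE' addrA addrK memvD ?memvN //.
have y0 : y = 0.
  apply/eqP/negPn/negP => nzy; case/eqP: lj; apply/esym.
  by apply: inj yj _ nzy; rewrite -[y]subr0 -yy' opprB addrC subrK.
by case/negP: vi; rewrite vE y0 addr0.
Qed.

Lemma on_line i v : v \notin P i -> exists2 j, j != i & v \in (P i + P j)%VS.
Proof.
apply: (pencil_cover n_gt0 dimP disjP dimW cardI).
  exact: line_meet.
by move=> j ji; rewrite lineI // eq_sym.
Qed.

Lemma meet_line i j k v : i != j -> v \in P k -> v != 0 ->
  v \in (P i + P j)%VS -> (P k <= P i + P j)%VS.
Proof.
move=> ij vk nzv vT; have [vi|vi] := boolP (v \in P i).
  by rewrite (inj vk vi nzv) addvSl.
have ki : k != i by apply: contraNneq vi => <-.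
rewrite (@line_meet i j k v) ?addvSr // 1?eq_sym //.
by rewrite (subvP (addvSr _ _)).
Qed.

Definition hole v := forall k, v \in P k -> v = 0.

Lemma hole_inP i j v : i != j -> v \in (P i + P j)%VS ->
  hole_in (P i + P j) v -> hole v.
Proof.
move=> ij vT hv k vk; apply/eqP/negPn/negP => nzv.
by have v0 := hv k (meet_line ij vk nzv vT) vk; rewrite v0 eqxx in nzv.
Qed.

Lemma holeN v : hole v -> hole (- v).
Proof. by move=> hv k; rewrite memvN => /hv->; rewrite oppr0. Qed.

Lemma holeZ a v : hole v -> hole (a *: v).
Proof.
have [->|nza] := eqVneq a 0; first by rewrite scale0r.
by move=> hv k; rewrite rpredZeq (negPf nza) => /hv->; rewrite scaler0.
Qed.

(** If [u + v] were in [P i], a line through [P i] containing [u] would also contain [v], which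
    reduces the claim to the holes of one line. *)
Lemma holeD u v : hole u -> hole v -> hole (u + v).
Proof.
move=> hu hv i uvi; have [ui|ui] := boolP (u \in P i).
  by move: uvi; rewrite (hu i ui) add0r; apply: hv.
have [j ji uT] := on_line ui; have ij : i != j by rewrite eq_sym.
have vT : v \in (P i + P j)%VS.
  by rewrite -(addKr u v) memvD ?memvN // (subvP (addvSl _ _)).
apply: (@hole_inD i j ij u v uT vT _ _ i (addvSl _ _) uvi) => k _.
  exact: hu.
exact: hv.
Qed.

Definition holeb (v : W) : bool := [forall k, (v \in P k) ==> (v == 0)].

Lemma holeP v : reflect (hole v) (holeb v).
Proof.
apply: (iffP forallP) => [h k vk|h k].
  by have := h k; rewrite vk => /eqP.
by apply/implyP=> /h/eqP.
Qed.

Definition hole_space : {vspace W} :=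
  <<[seq (v : W) | v <- enum (finvect_type W) & holeb v]>>%VS.

Lemma in_hole_space v : reflect (hole v) (v \in hole_space).
Proof.
apply: (iffP idP) => [|hv]; last first.
  apply/memv_span/mapP; exists v => //.
  rewrite mem_filter; apply/andP; split; first exact/holeP.
  exact: (mem_enum (finvect_type W) v).
rewrite /hole_space; set s := map _ _; move=> vs.
have hs u : u \in s -> hole u.
  by case/mapP=> w; rewrite mem_filter => /andP[/holeP hw _] ->.
rewrite (@coord_span _ _ _ (in_tuple s) v vs).
apply: (big_ind hole) => [k //||i _]; first exact: holeD.
by apply/holeZ/hs/mem_nth.
Qed.

Lemma hole_space_cap i : (P i :&: hole_space = 0)%VS.
Proof.
apply/eqP; rewrite -subv0; apply/subvP=> v; rewrite memv_cap memv0.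
by case/andP=> vi /in_hole_space hv; apply/eqP/(hv i).
Qed.

(** On a line through [P i] and [v], [eta] splits off a hole that is congruent to [v] modulo
    [P i]. *)
Lemma hole_space_add i : (P i + hole_space = fullv)%VS.
Proof.
apply/eqP; rewrite eqEsubv subvf /=; apply/subvP=> v _.
have [vi|vi] := boolP (v \in P i); first by rewrite (subvP (addvSl _ _)).
have [j ji vT] := on_line vi; have ij : i != j by rewrite eq_sym.
have [vE hE _] := eta_coset ij vT vi.
rewrite -[v](subrK (eta i j v)) memv_add //; apply/in_hole_space.
apply: (hole_inP ij _ hE); rewrite -[eta _ _ _](subKr v) memvB //.
by rewrite (subvP (addvSl _ _)).
Qed.

Local Notation H := hole_space.

Lemma hole_cap_dim i j : i != j ->
  (\dim ((P i + P j) :&: H) <= n)%N.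
Proof.
move=> ij; have H0 : (P i :&: ((P i + P j) :&: H) = 0)%VS.
  by apply/eqP; rewrite -subv0 -(hole_space_cap i) capvS // capvSr.
rewrite -(leq_add2l n) -{1}(dimP i) -(dimv_disjoint_sum H0) -(dimL ij).
by rewrite dimvS // subv_add addvSl capvSl.
Qed.

(* Two lines of a plane that share a hole share all their holes: all elements
   meeting the plane are contained in it, so both lines lie in the plane and
   meet in a space of dimension at least [n], which can only consist of holes. *)
Lemma parallel_lines a b i j v h : a != b -> j != i ->
  ~~ (P i <= P a + P b)%VS -> hole v -> v != 0 ->
  v \in (P a + P b)%VS -> v \in (P i + P j)%VS ->
  hole h -> h \in (P a + P b)%VS -> h \in (P i + P j)%VS.
Proof.
move=> ab ji iT hv nzv vT vT' hh hT.
have ij : i != j by rewrite eq_sym.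
have ia : i != a by apply: contraNneq iT => ->; rewrite addvSl.
have ai : a != i by rewrite eq_sym.
have [c [ci ca cl]] := third_on_line ia.
have acE : (P a + P c = P a + P i)%VS.
  by apply: line_eq; rewrite ?dimL ?addvSl // 1?eq_sym // addvC.
have cT : ~~ (P c <= P a + P b)%VS.
  apply: contra iT => cT; apply: (subv_trans (addvSr (P a) (P i))).
  by rewrite -acE subv_add addvSl.
have [x xi nzx] := nz_in i.
have xv : ~ hole (x + v).
  move=> hxv; case/eqP: nzx; have hx : hole x.
    by rewrite -[x](addrK v); apply: holeD => //; apply: holeN.
  exact: hx xi.
have [k uk nzu] : exists2 k, x + v \in P k & x + v != 0.
  move/holeP: xv; rewrite negb_forall => /existsP[k].
  by rewrite negb_imply => /andP[]; exists k.
have uT' : x + v \in (P i + P j)%VS by rewrite memvD // (subvP (addvSl _ _)).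
have kT' : (P k <= P i + P j)%VS by apply: meet_line uk nzu uT'.
have ki : k != i.
  apply: contraNneq nzv => ki; rewrite ki in uk.
  by rewrite (hv i) // -(addKr x v) memvD ?memvN.
have T'E : (P i + P k = P i + P j)%VS.
  by apply: line_eq; rewrite ?dimL ?addvSl // eq_sym.
(* With [x = y + x'] along [P a + P c], the vector [y + v] is no hole, so it lies on some [P z] of
   the line [P a + P b]. Then [x + v = x' + (y + v)] puts [P k] on the line [P c + P z] of the
   plane. *)
have kpi : (P k <= P i + (P a + P b))%VS.
  have [y ya [x' xc xE]] :
      exists2 y, y \in P a & exists2 x', x' \in P c & x = y + x'.
    by apply/memv_addP; rewrite acE (subvP (addvSr _ _)).
  have tT : y + v \in (P a + P b)%VS by rewrite memvD // (subvP (addvSl _ _)).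
  have [ht|] := boolP (holeb (y + v)).
    move/holeP: ht => ht; case/eqP: nzx.
    have hy : hole y by rewrite -[y](addrK v); apply: holeD => //; apply: holeN.
    have y0 := hy a ya; rewrite y0 add0r in xE.
    apply/eqP/negPn/negP => nzx; case/eqP: ci; apply/esym.
    by apply: inj xi _ nzx; rewrite xE.
  rewrite negb_forall => /existsP[z]; rewrite negb_imply => /andP[tz nzt].
  have zT : (P z <= P a + P b)%VS by apply: meet_line tz nzt tT.
  have cz : c != z by apply: contraNneq cT => ->.
  have ukz : x + v \in (P c + P z)%VS by rewrite xE addrAC addrC memv_add.
  apply: (subv_trans (meet_line cz uk nzu ukz)).
  rewrite subv_add; apply/andP; split; last exact: subv_trans (addvSr _ _).
  apply: (subv_trans cl); rewrite subv_add addvSl /=.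
  by apply: (subv_trans (addvSl (P a) (P b))); exact: addvSr.
have dim_pi : (\dim (P i + (P a + P b)) <= n + (n + n))%N.
  by apply: (leq_trans (dimv_add_leqif _ _)); rewrite dimP dimL.
have cap_dim : (n <= \dim ((P a + P b) :&: (P i + P j)))%N.
  rewrite -(leq_add2l (\dim ((P a + P b) + (P i + P j)))) dimv_sum_cap !dimL //.
  have -> : (n + n + (n + n) = n + (n + n) + n)%N by rewrite -addnA [RHS]addnC.
  rewrite leq_add2r; apply: leq_trans dim_pi; rewrite dimvS // subv_add addvSr /=.
  by rewrite -T'E subv_add addvSl.
(* A nonzero common vector on some [P z] would put [P z] on both lines; sharing also [v] outside
   [P z], they would coincide by [line_meet]. *)
have capH : ((P a + P b) :&: (P i + P j) <= H)%VS.
  apply/subvP=> s; rewrite memv_cap => /andP[sT sT'].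
  apply/in_hole_space => z sz; apply/eqP/negPn/negP => nzs.
  have zT := meet_line ab sz nzs sT; have zT' := meet_line ij sz nzs sT'.
  have vz : v \notin P z by apply: contraNN nzv => /hv->.
  have [z' zz' zl] : exists2 z', z' != z & (P z + P z' = P a + P b)%VS.
    have [za|za] := eqVneq z a; [exists b|exists a]; rewrite 1?eq_sym // ?za //.
    by apply: line_eq; rewrite ?dimL ?addvSl.
  have [z'' zz'' zl''] : exists2 z', z' != z & (P z + P z' = P i + P j)%VS.
    have [zi|zi] := eqVneq z i; [exists j|exists i]; rewrite 1?eq_sym // ?zi //.
    by apply: line_eq; rewrite ?dimL ?addvSl.
  case/negP: iT; rewrite -zl (@line_meet z z' z'' v) ?zl ?zl'' //.
  exact: addvSl.
(* The intersection has dimension at least [n] and the holes of a line at most [n]. *)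
have capE : ((P a + P b) :&: (P i + P j) = (P a + P b) :&: H)%VS.
  apply/eqP; rewrite eqEdim (leq_trans (hole_cap_dim ab)) // andbT.
  by rewrite subv_cap capvSl capH.
have : h \in ((P a + P b) :&: H)%VS by rewrite memv_cap hT; apply/in_hole_space.
by rewrite -capE memv_cap => /andP[].
Qed.

(** * The product [star] on holes and the field it generates *)

Section Star.
Variables (i0 : I) (e : W).
Hypothesis eX : e \in P i0.
Hypothesis e_neq0 : e != 0.
Local Notation X := (P i0).

(** The default [i0] is never reached for [w] in [H]: [e + w] is not a hole, as otherwise [e] would
    be one. *)
Definition elt w := odflt i0 [pick k | e + w \in P k].
(** [P (elt w)] restricted to [X] is the graph of [x |-> star x w]: projecting [x] onto [P (elt w)]
    along [H] gives [x + star x w]. *)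
Definition star x w := daddv_pi (P (elt w)) H x - x.
Local Notation T w := (X + P (elt w))%VS.

Lemma XH0 v : v \in X -> v \in H -> v = 0.
Proof. by move=> vX /in_hole_space/(_ i0 vX). Qed.

Lemma eltP w : w \in H -> e + w \in P (elt w).
Proof.
move=> wH; rewrite /elt; case: pickP => //= none.
case/eqP: e_neq0; apply: XH0 => //; rewrite -[e](addrK w) memvB //.
by apply/in_hole_space => k; rewrite none.
Qed.

Lemma elt_uniq w k : w \in H -> e + w \in P k -> elt w = k.
Proof.
move=> wH wk; apply: inj (eltP wH) wk _; apply: contraNneq e_neq0 => ew0.
by apply/eqP/XH0 => //; rewrite -[e](addrK w) ew0 sub0r memvN.
Qed.

Lemma star_spec x w : star x w \in H /\ x + star x w \in P (elt w).
Proof.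
have xf : x \in (P (elt w) + H)%VS by rewrite hole_space_add memvf.
split; last by rewrite /star subrKC memv_pi.
by rewrite /star -{2}(daddv_pi_add (hole_space_cap _) xf) opprD addNKr memvN memv_pi.
Qed.

Lemma star_uniq x w h : h \in H -> x + h \in P (elt w) -> star x w = h.
Proof.
move=> hH xh; rewrite /star -{1}[x](addrK h) daddv_piD ?memvN ?hole_space_cap //.
by rewrite addrC addKr.
Qed.

Lemma star_in_T x w : x \in X -> star x w \in T w.
Proof.
move=> xX; have [_ sP] := star_spec x w.
by rewrite -(addKr x (star x w)) memv_add ?memvN.
Qed.

Lemma in_T w : w \in H -> w \in T w.
Proof. by move=> wH; rewrite -[X in X \in _](addKr e w) memv_add ?memvN ?eltP. Qed.

Lemma elt_neq w : w \in H -> w != 0 -> elt w != i0.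
Proof.
move=> wH; apply: contraNneq => ei; apply/eqP/XH0 => //.
by have := eltP wH; rewrite ei => ew; rewrite -(addKr e w) memvD ?memvN.
Qed.

Lemma in_T_star w h : h \in H -> h \in T w -> exists2 x, x \in X & h = star x w.
Proof.
move=> hH /memv_addP[x xX [p pP hE]]; exists (- x); rewrite ?memvN //.
by apply/esym/star_uniq; rewrite // hE addKr.
Qed.

Lemma T_eq w h : w \in H -> h \in H -> w != 0 -> h != 0 -> h \in T w -> T h = T w.
Proof.
move=> wH hH nzw nzh hT; apply: (line_meet (v := h)); rewrite ?elt_neq ?in_T //.
by apply: contraNN nzh => hX; apply/eqP/XH0.
Qed.

Lemma starDl x y w : star (x + y) w = star x w + star y w.
Proof. by rewrite /star linearD opprD addrACA. Qed.

Lemma starZl a x w : star (a *: x) w = a *: star x w.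
Proof. by rewrite /star linearZ /= scalerBr. Qed.

Lemma star1 w : w \in H -> star e w = w.
Proof. by move=> wH; apply: star_uniq => //; apply: eltP. Qed.

Lemma star0r x : x \in X -> star x 0 = 0.
Proof.
move=> xX; have e0 : elt 0 = i0 by apply: elt_uniq; rewrite ?mem0v ?addr0.
by apply: star_uniq; rewrite ?mem0v // e0 addr0.
Qed.

Lemma star0l w : star 0 w = 0.
Proof. by rewrite /star linear0 subr0. Qed.

Lemma star_eq0 x w : x \in X -> w \in H -> star x w = 0 -> x = 0 \/ w = 0.
Proof.
move=> xX wH sx0; have [->|nzx] := eqVneq x 0; [by left | right].
apply/eqP/negPn/negP => nzw; case/eqP: (elt_neq wH nzw).
by have [_] := star_spec x w; rewrite sx0 addr0 => xP; apply: inj xP xX nzx.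
Qed.

(** A nonzero [star y w] is a hole of [T w], so it spans the same line with [X], and every hole of
    [T w] has the form [star z w]. *)
Lemma star_closed x y w : x \in X -> y \in X -> w \in H ->
  exists2 z, z \in X & star x (star y w) = star z w.
Proof.
move=> xX yX wH; have [yw0|nzyw] := eqVneq (star y w) 0.
  by exists 0; rewrite ?mem0v // yw0 star0r // star0l.
have nzw : w != 0 by apply: contraNneq nzyw => ->; rewrite star0r.
have [ywH _] := star_spec y w; have [xywH _] := star_spec x (star y w).
apply: in_T_star => //.
by rewrite -(T_eq wH ywH nzw nzyw (star_in_T _ yX)) star_in_T.
Qed.

(** The line joining [P (elt w)] and [P (elt (w + w'))] contains both the difference and the hole
    [w'], so it is parallel to [T w'] and has the same holes. *)
Lemma star_add_parallel x w w' : x \in X -> w \in H -> w' \in H ->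
  w != 0 -> w' != 0 -> T w != T w' ->
  star x (w + w') - star x w \in T w'.
Proof.
move=> xX wH w'H nzw nzw' Tww'.
have wwH : w + w' \in H by rewrite memvD.
have kl : elt w != elt (w + w').
  apply: contraNneq nzw' => kl; apply/eqP.
  apply: (in_hole_space _ w'H (elt w)).
  by rewrite -[X in X \in _](addKr (e + w) w') -addrA memvD ?memvN ?eltP // kl eltP.
have [sH sP] := star_spec x w; have [sH' sP'] := star_spec x (w + w').
have dT : star x (w + w') - star x w \in (P (elt w) + P (elt (w + w')))%VS.
  have -> : star x (w + w') - star x w = - (x + star x w) + (x + star x (w + w')).
    by rewrite [- (x + _)]opprD addrACA addNr add0r addrC.
  by rewrite memv_add // memvN.
have w'T : w' \in (P (elt w) + P (elt (w + w')))%VS.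
  by rewrite -[X in X \in _](addKr (e + w) w') -addrA memv_add ?memvN ?eltP.
have ew' := elt_neq w'H nzw'.
have XT : ~~ (X <= P (elt w) + P (elt (w + w')))%VS.
  apply: contra Tww' => XT; have XE : T w = (P (elt w) + P (elt (w + w')))%VS.
    by apply: line_eq; rewrite ?dimL ?addvSl // eq_sym elt_neq.
  by rewrite eq_sym; apply/eqP/T_eq; rewrite // XE.
have hw' : hole w' by apply/in_hole_space.
apply: (parallel_lines kl ew' XT hw' nzw' w'T (in_T w'H) _ dT).
by apply/in_hole_space; rewrite memvB.
Qed.

(** By [star_add_parallel], used twice with [w] and [w'] exchanged, the defect of additivity is a
    hole in both [T w] and [T w'], hence 0. *)
Lemma star_add_sep x w w' : x \in X -> w \in H -> w' \in H -> w != 0 ->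
  w' \notin T w -> star x (w + w') = star x w + star x w'.
Proof.
move=> xX wH w'H nzw w'T.
have nzw' : w' != 0 by apply: contraNneq w'T => ->; rewrite mem0v.
have Tww' : T w != T w' by apply: contraNneq w'T => ->; apply: in_T.
have Tw'w : T w' != T w by rewrite eq_sym.
have [sH _] := star_spec x w; have [sH' _] := star_spec x w'.
have [sH'' _] := star_spec x (w + w').
apply/eqP; rewrite -subr_eq0 opprD addrA; set d := _ - _.
have dT' : d \in T w' by rewrite memvB ?star_in_T ?star_add_parallel.
have dT : d \in T w.
  have := star_add_parallel xX w'H wH nzw' nzw Tw'w; rewrite [w' + w]addrC.
  rewrite /d; move: (star_in_T w xX); move: (star x w) (star x w') (star _ _).
  by move=> a b c aT cbT; rewrite addrAC memvB.
have dH : d \in H by exact: memvB (memvB _ _) _.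
apply/negPn/negP => nzd; case/eqP: Tww'.
by rewrite -(T_eq wH dH nzw nzd dT) (T_eq w'H dH nzw' nzd dT').
Qed.

(** When [w'] lies in [T w], an auxiliary [u] off that line lets [star x (w + w' + u)] be expanded
    in two ways by the separated case. *)
Lemma star_add x w w' u : x \in X -> w \in H -> w' \in H ->
  u \in H -> u \notin T w -> u \notin T w' -> w != 0 -> w' != 0 ->
  star x (w + w') = star x w + star x w'.
Proof.
move=> xX wH w'H uH uw uw' nzw nzw'.
have [Tww'|w'T] := boolP (w' \in T w); last exact: star_add_sep.
have E1 : star x (w + w' + u) = star x (w + w') + star x u.
  have [->|nzs] := eqVneq (w + w') 0; first by rewrite add0r star0r // add0r.
  apply: star_add_sep => //; first exact: memvD.
  by rewrite (@T_eq w) ?memvD // in_T.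
have E2 : star x (w + (w' + u)) = star x w + star x (w' + u).
  apply: star_add_sep => //; first exact: memvD.
  by apply: contra uw => wuT; rewrite -(addKr w' u) memvD ?memvN.
have E3 : star x (w' + u) = star x w' + star x u by apply: star_add_sep.
move: E1; rewrite -addrA E2 E3 addrA.
by move: (star _ _) (star _ _) (star _ _) (star _ _) => a b c d /addIr.
Qed.

Lemma dim_hole_space : \dim H = m.
Proof.
apply: (@addnI n); rewrite -dimW -(hole_space_add i0).
by rewrite dimv_disjoint_sum ?hole_space_cap // dimP.
Qed.

(** A line has at most an [n]-space of holes, while [H] has dimension [m > n]. *)
Lemma off_T u : (n < m)%N -> u \in H -> u != 0 -> exists2 v, v \in H & v \notin T u.
Proof.
move=> nm uH nzu; apply/subvPn; apply/negP => HT.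
have := hole_cap_dim (i := i0) (j := elt u).
rewrite eq_sym elt_neq // (capv_idPr HT) dim_hole_space leqNgt nm => /(_ isT) //.
Qed.

Lemma starDr x w w' : (n < m)%N -> x \in X -> w \in H -> w' \in H ->
  star x (w + w') = star x w + star x w'.
Proof.
move=> nm xX wH w'H.
have [->|nzw] := eqVneq w 0; first by rewrite star0r // !add0r.
have [->|nzw'] := eqVneq w' 0; first by rewrite star0r // !addr0.
have [u uH uw] := off_T nm wH nzw.
have [uw''|uw''] := boolP (u \in T w'); last exact: (star_add xX wH w'H uH).
have [Tww'|w'T] := boolP (w' \in T w); last exact: star_add_sep.
by case/negP: uw; rewrite -(T_eq wH w'H nzw nzw' Tww').
Qed.

Let star' (x : subvs_of X) (w : subvs_of H) : subvs_of H :=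
  vsproj H (star (vsval x) (vsval w)).

Let star'E x w : vsval (star' x w) = star (vsval x) (vsval w).
Proof. by rewrite /star' vsprojK //; case: (star_spec (vsval x) (vsval w)). Qed.

(** [star_field] is applied to [star] restricted to the subspace types of [X] and [H], with [w0] a
    nonzero hole and [w1] a hole off its line. *)
Lemma kernel_field : (n < m)%N ->
  exists (K : fieldExtType F) (kappa : {linear K -> W}),
    [/\ injective kappa /\ kappa 1 = e,
        forall x, x \in X <-> exists a, x = kappa a,
        forall a b w, w \in H ->
          star (kappa (a * b)) w = star (kappa a) (star (kappa b) w)
      & forall a x w, x \in X -> w \in H -> star x (a *: w) = a *: star x w].
Proof.
move=> nm.
have nzH : vpick H != 0.
  by rewrite vpick0 -dimv_eq0 dim_hole_space -lt0n (ltn_trans n_gt0).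
have [v vH vT] := off_T nm (memv_pick H) nzH.
have H' (w : subvs_of H) : vsval w \in H := subvsP w.
have X' (x : subvs_of X) : vsval x \in X := subvsP x.
have sDl x y w : star' (x + y) w = star' x w + star' y w.
  by apply: val_inj; rewrite /= !star'E -starDl.
have sZl a x w : star' (a *: x) w = a *: star' x w.
  by apply: val_inj; rewrite /= !star'E -starZl.
have sDr x w w' : star' x (w + w') = star' x w + star' x w'.
  by apply: val_inj; rewrite /= !star'E -starDr.
have s1 w : star' (vsproj X e) w = w.
  by apply: val_inj; rewrite /= star'E vsprojK // star1.
have s0 x w : star' x w = 0 -> x = 0 \/ w = 0.
  move=> E; have : star (vsval x) (vsval w) = 0 by rewrite -star'E E.
  by case/(star_eq0 (X' x) (H' w)) => E0; [left | right]; apply: val_inj.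
have sC x y w : exists z, star' x (star' y w) = star' z w.
  have [z zX E] := star_closed (X' x) (X' y) (H' w).
  by exists (vsproj X z); apply: val_inj; rewrite /= !star'E E vsprojK.
have nz0 : vsproj H (vpick H) != 0.
  apply: contraNneq nzH => E; apply/eqP.
  by rewrite -(vsprojK (memv_pick H)) E.
have nin x : star' x (vsproj H (vpick H)) <> vsproj H v.
  move/(congr1 vsval); rewrite star'E !vsprojK ?memv_pick // => E.
  by case/negP: vT; rewrite -E star_in_T.
have [K [kappa [kbij k1 kM sZ]]] := star_field sDl sZl sDr s1 s0 sC nz0 nin.
pose k : K -> W := fun a => vsval (kappa a).
have klin : linear k by move=> a x y; rewrite /k !linearP.
pose kL : {linear K -> W} := HB.pack k (GRing.isLinear.Build F K W _ k klin).
exists K, kL; split.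
- split; first by move=> a b /val_inj/(bij_inj kbij).
  by rewrite /= /k k1 vsprojK.
- move=> x; split=> [xX|[a ->]]; last exact: X'.
  have [ki _ kiK] := kbij; exists (ki (vsproj X x)).
  by rewrite /= /k kiK vsprojK.
- move=> a b w wH; have := congr1 vsval (kM a b (vsproj H w)).
  by rewrite !star'E vsprojK.
move=> a x w xX wH; have := congr1 vsval (sZ a (vsproj X x) (vsproj H w)).
by rewrite linearZ /= !star'E linearZ /= !vsprojK.
Qed.

Lemma desarguesian_coordinates_at : (n < m)%N ->
  exists (K : fieldExtType F) (r : nat)
         (psi : {linear W -> 'rV[K]_r | in_alg K \; *:%R}),
    [/\ \dim {:K} = n, bijective psi
      & forall i, exists2 u : 'rV[K]_r, u != 0 &
          forall v, (v \in P i) = (psi v \in <[u]>%VS)].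
Proof.
move=> nm; have [K [kappa [[kinj k1] kX kM sZ]]] := kernel_field nm.
have kapX a : kappa a \in X by apply/kX; exists a.
pose pX := daddv_pi X H; pose pH := daddv_pi H X.
have HX0 : (H :&: X = 0)%VS by rewrite capvC hole_space_cap.
have pHP w : pH w \in H by apply: memv_pi.
have pE w : pX w + pH w = w.
  by rewrite daddv_pi_add ?hole_space_cap // hole_space_add memvf.
have pXE x h : x \in X -> h \in H -> pX (x + h) = x.
  by move=> xX hH; apply: daddv_piD => //; apply: hole_space_cap.
have pHE x h : x \in X -> h \in H -> pH (x + h) = h.
  by move=> xX hH; rewrite addrC; apply: daddv_piD.
have ex w : exists a, pX w == kappa a.
  by have /kX[a ->] : pX w \in X := memv_pi _ _ _; exists a.
pose c w := xchoose (ex w).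
have cP w : kappa (c w) = pX w by apply/esym/eqP/(xchooseP (ex w)).
have cE a h : h \in H -> c (kappa a + h) = a.
  by move=> hH; apply: kinj; rewrite cP pXE.
(* [K] acts on [W = X + H] by field multiplication on [X], through [kappa], and by [star] on [H]. *)
pose act a w := kappa (a * c w) + star (kappa a) (pH w).
have starH x h : star x h \in H by case: (star_spec x h).
have cD v w : c (v + w) = c v + c w by apply: kinj; rewrite linearD /= !cP linearD.
have cZ k w : c (k *: w) = k *: c w by apply: kinj; rewrite linearZ /= !cP linearZ.
have kapZ k a : kappa (k *: a) = k *: kappa a by rewrite linearZ.
have pHZ k w : pH (k *: w) = k *: pH w by rewrite linearZ.
have actDl a b w : act (a + b) w = act a w + act b w.
  by rewrite /act mulrDl !(linearD kappa) /= starDl addrACA.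
have actDr a v w : act a (v + w) = act a v + act a w.
  rewrite /act cD mulrDr (linearD kappa) (linearD pH).
  by rewrite starDr ?kapX ?pHP // addrACA.
have actZr k a w : act a (k *: w) = k *: act a w.
  rewrite /act cZ -scalerAr kapZ pHZ scalerDr; congr (_ + _).
  exact: sZ (kapX _) (pHP _).
have actA a b w : act (a * b) w = act a (act b w).
  rewrite [act b w]/act /act cE ?starH // pHE ?kapX ?starH // mulrA; congr (_ + _).
  exact: kM (pHP _).
have actF k w : act (k%:A) w = k *: w.
  by rewrite /act mulr_algl !kapZ k1 cP starZl star1 ?pHP // -scalerDr pE.
have [r [psi [psi_bij psi_act]]] := action_coordinates actDl actDr actZr actA actF.
exists K, r, psi; split=> //.
  have kinjL : lker (linfun kappa) == 0%VS.
    by apply/lker0P => a b; rewrite !lfunE => /kinj.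
  rewrite -(dimP i0) -(limg_dim_eq (f := linfun kappa)).
    congr (\dim _); apply/vspaceP=> x.
    apply/idP/idP=> [/memv_imgP[a _ ->]|/kX[a ->]].
      by rewrite lfunE.
    by rewrite -[kappa a](lfunE kappa) memv_img ?memvf.
  by rewrite (eqP kinjL) capv0.
move=> i.
have [w0 w0H w0P] : exists2 w, w \in H & e + w \in P i.
  have ei : e \in (P i + H)%VS by rewrite hole_space_add memvf.
  exists (- daddv_pi H (P i) e); first by rewrite memvN memv_pi.
  by rewrite -{1}(daddv_pi_add (hole_space_cap i) ei) addrK memv_pi.
have elt0 : elt w0 = i by apply: elt_uniq.
(* The [K]-line of [e + w0] is thus the graph of [x |-> star x w0], which is [P i]. *)
have actE a : act a (e + w0) = kappa a + star (kappa a) w0.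
  by rewrite /act pHE // -{1}k1 cE // mulr1.
exists (psi (e + w0)).
  have psi_inj := bij_inj psi_bij.
  rewrite -(linear0 psi) (inj_eq psi_inj); apply: contraNneq e_neq0 => ew0.
  by rewrite -[e](pXE e w0) // ew0 /pX linear0.
move=> v; apply/idP/vlineP=> [vP|[a]]; last first.
  rewrite -psi_act => /(bij_inj psi_bij) ->; rewrite actE -elt0.
  by case: (star_spec (kappa a) w0).
exists (c v); rewrite -psi_act actE cP; congr (psi _).
rewrite -{1}(pE v); congr (_ + _); apply/esym/star_uniq => //.
by rewrite elt0 pE.
Qed.
End Star.

Lemma desarguesian_coordinates : (n < m)%N ->
  exists (K : fieldExtType F) (r : nat)
         (psi : {linear W -> 'rV[K]_r | in_alg K \; *:%R}),
    [/\ \dim {:K} = n, bijective psi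
      & forall i, exists2 u : 'rV[K]_r, u != 0 &
          forall v, (v \in P i) = (psi v \in <[u]>%VS)].
Proof.
have /card_gt0P[i0 _] : (0 < #|I|)%N by rewrite cardI expn_gt0 ltnW ?finNzRing_gt1.
by have [e eX nze] := nz_in i0; apply: desarguesian_coordinates_at eX nze.
Qed.

End Holes.

(** * The parity bound for odd [q] *)

Lemma even_card_matching (T : finType) (J : {set T}) (R : rel T) :
  symmetric R -> irreflexive R ->
  (forall x, x \in J -> #|[set y in J | R x y]| = 1%N) -> ~~ odd #|J|.
Proof.
move=> Rsym Rirr R1.
have Runiq x y z : x \in J -> y \in J -> z \in J -> R x y -> R x z -> y = z.
  move=> xJ yJ zJ xy xz; have /eqP/cards1P[t tE] := R1 x xJ.
  have : y \in [set y in J | R x y] by rewrite inE yJ.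
  have : z \in [set y in J | R x y] by rewrite inE zJ.
  by rewrite tE !inE => /eqP-> /eqP->.
(* The classes of [E] are the pairs formed by an element and its partner. *)
pose E x y := (x == y) || R x y.
have Eequiv : {in J & &, equivalence_rel E}.
  move=> x y z xJ yJ zJ; split; first by rewrite /E eqxx.
  case/predU1P=> [->//|xy]; apply/idP/idP; case/predU1P=> [<-|xz].
  - by rewrite /E Rsym xy orbT.
  - by rewrite (Runiq x y z) // /E eqxx.
  - by rewrite /E xy orbT.
  by rewrite Rsym in xy; rewrite (Runiq y x z) // /E eqxx.
have partJ := equivalence_partitionP Eequiv.
rewrite (card_uniform_partition (n := 2) _ partJ) ?oddM ?andbF //.
move=> _ /imsetP[x xJ ->].
have /eqP/cards1P[t tE] := R1 x xJ.
have inR y : (y \in J) && R x y = (y == t) by rewrite -in_set1 -tE inE.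
have -> : [set y in J | E x y] = [set x; t].
  apply/setP=> y; rewrite !inE /E andb_orr inR eq_sym.
  by have [->|] := eqVneq y x; rewrite ?xJ ?andbF.
rewrite cards2; have [xt|//] := eqVneq x t.
by have := inR x; rewrite -xt Rirr andbF eqxx.
Qed.

Section Hyperoval.
Variables (F : finFieldType) (V : vectType F) (I : finType).
Variables (Q : I -> {vspace V}) (n : nat) (S : {vspace V}) (J : {set I}).
Local Notation q := #|F|.
Hypothesis n_gt0 : (0 < n)%N.
Hypothesis dimQ : forall i, \dim (Q i) = n.
Hypothesis disjQ : forall i j, i != j -> (Q i :&: Q j = 0)%VS.
Hypothesis dim3 : forall i j k, i != j -> i != k -> j != k ->
  \dim (Q i + Q j + Q k) = (3 * n)%N.
Hypothesis dimS : \dim S = (3 * n)%N.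
Hypothesis QS : forall j, j \in J -> (Q j <= S)%VS.

Lemma triple_cap i j k : i != j -> i != k -> j != k -> ((Q i + Q j) :&: Q k = 0)%VS.
Proof.
move=> ij ik jk; apply/eqP; rewrite -dimv_eq0.
have := dimv_sum_cap (Q i + Q j) (Q k); rewrite dim3 // dimQ => E.
have := dimv_sum_cap (Q i) (Q j); rewrite !dimQ => E'.
by lia.
Qed.

(* If [q ^ n + 2] elements were contained in [S], then for a point [p] of [S]
   on none of them, [p \in Q i + Q j] would be a perfect matching on them. *)
Lemma hyperoval_bound : odd q -> (#|J| <= q ^ n + 1)%N.
Proof.
move=> q_odd; rewrite leqNgt; apply/negP => J_gt.
have dimL := dim_line dimQ disjQ.
(* By [triple_cap] the sets [Q g + Q j] minus [Q g] are disjoint for distinct [j]. At most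
   [q ^ n + 1] of them fit into [S] minus [Q g], so with [q ^ n + 2] elements they cover it exactly
   once. *)
have count g v : g \in J -> v \in S -> v \notin Q g ->
    #|J| = (q ^ n + 2)%N /\
    #|[set j in J | (g != j) && (v \in (Q g + Q j)%VS)]| = 1%N.
  move=> gJ vS vg; pose v' : finvect_type V := v.
  have [] := @double_count _ _ (vset S :\: vset (Q g)) (J :\ g)
    (fun j => vset (Q g + Q j) :\: vset (Q g)) (q ^ (n + n) - q ^ n) 1.
  - move=> j; rewrite !inE => /andP[_ jJ].
    by rewrite setSD // vset_sub // subv_add !QS.
  - move=> j; rewrite !inE => /andP[jg _].
    by rewrite card_vsetD ?addvSl // dimL 1?eq_sym // dimQ.
  - move=> u _; apply/card_le1P => j; rewrite !inE => /and3P[/andP[jg jJ] ug uj] k.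
    rewrite !inE; apply/idP/eqP=> [/and3P[/andP[kg kJ] _ uk]|->].
      2: by rewrite jg jJ ug.
    apply/eqP/negPn/negP => kj; case/negP: ug.
    case/memv_addP: uk => a ag [c ck uE].
    have : c \in ((Q g + Q j) :&: Q k)%VS.
      have aT := subvP (addvSl (Q g) (Q j)) _ ag.
      by rewrite memv_cap ck andbT -(addKr a c) -uE memvD ?memvN.
    rewrite triple_cap 1?eq_sym // memv0 => /eqP c0.
    by rewrite uE c0 addr0.
  have cJ : #|J| = #|J :\ g|.+1 by rewrite (cardsD1 g) gJ.
  rewrite card_vsetD ?QS // dimS dimQ muln1.
  have -> : (q ^ (3 * n) - q ^ n = (q ^ n + 1) * (q ^ (n + n) - q ^ n))%N.
    rewrite mulnBr !mulnDl !mul1n -!expnD.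
    have -> : (n + (n + n) = 3 * n)%N by lia.
    by move: (q ^ (3 * n))%N (q ^ (n + n))%N (q ^ n)%N => x y z; lia.
  have b_gt0 : (0 < q ^ (n + n) - q ^ n)%N.
    by rewrite subn_gt0 ltn_exp2l ?finNzRing_gt1 // -[X in (X < _)%N]addn0 ltn_add2l.
  rewrite leq_pmul2r // => J'_le all1.
  have J'E : #|J :\ g| = (q ^ n + 1)%N by lia.
  split; first by rewrite cJ J'E addn2 addn1.
  rewrite -(all1 _ v') ?J'E //; last by rewrite !inE vg.
  apply: eq_card => j; rewrite !inE vg /v' [g == j]eq_sym.
  by case: (j == g); rewrite ?andbF ?andbT /=.
have [a aJ] : exists a, a \in J by apply/card_gt0P; lia.
have [b] : exists b, b \in J :\ a.
  by apply/card_gt0P; move: J_gt; rewrite (cardsD1 a J) aJ; lia.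
rewrite !inE => /andP[ba bJ].
have nz_in i : exists2 v, v \in Q i & v != 0.
  exists (vpick (Q i)); first exact: memv_pick.
  by rewrite vpick0 -dimv_eq0 dimQ -lt0n.
have [x xa nzx] := nz_in a; have [y yb nzy] := nz_in b.
(* The point [p] is a sum of nonzero vectors of two elements of [J]; by [triple_cap] it lies on no
   element of [J]. *)
have pS : x + y \in S.
  by apply: memvD; [apply: (subvP (QS aJ)) | apply: (subvP (QS bJ))].
have pQ k : k \in J -> x + y \notin Q k.
  move=> kJ; apply/negP => pk.
  have [ka|ka] := eqVneq k a.
    case/eqP: ba; apply: (disj_eq disjQ yb _ nzy).
    by rewrite -(addKr x y) memvD ?memvN // -ka.
  have [kb|kb] := eqVneq k b.
    case/eqP: ka; rewrite kb; apply: (disj_eq disjQ (v := x)) => //.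
    by rewrite -[x](addrK y) memvB // -kb.
  have : x + y \in ((Q a + Q b) :&: Q k)%VS by rewrite memv_cap memv_add.
  rewrite triple_cap 1?eq_sym // memv0 addr_eq0 => /eqP xy.
  case/eqP: ba; apply: (disj_eq disjQ yb _ nzy).
  by rewrite -memvN -xy.
have : ~~ odd #|J|.
  apply: (@even_card_matching _ _
    (fun i j => (i != j) && (x + y \in (Q i + Q j)%VS))).
  - by move=> i j; rewrite eq_sym addvC.
  - by move=> i; rewrite eqxx.
  by move=> g gJ; case: (count g _ gJ pS (pQ g gJ)).
have [-> _] := count a _ aJ pS (pQ a aJ).
by rewrite oddD oddX q_odd orbT.
Qed.
End Hyperoval.

(** * The case of points, and auxiliary facts on finite sets and quotients *)

Lemma coordinates_dim1 (F : finFieldType) (W : vectType F) (I : finType)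
    (P : I -> {vspace W}) :
  (forall i, \dim (P i) = 1%N) ->
  exists (K : fieldExtType F) (r : nat)
         (psi : {linear W -> 'rV[K]_r | in_alg K \; *:%R}),
    [/\ \dim {:K} = 1%N, bijective psi
      & forall i, exists2 u : 'rV[K]_r, u != 0 &
          forall v, (v \in P i) = (psi v \in <[u]>%VS)].
Proof.
move=> dimP; pose K : fieldExtType F := F^o.
have [|||||r [psi [psi_bij psiZ]]] :=
  @action_coordinates F K W (fun (a : F) w => a *: w).
- by move=> a b w; apply: scalerDl.
- by move=> a v w; apply: scalerDr.
- by move=> k a w; rewrite !scalerA mulrC.
- by move=> a b w; rewrite scalerA.
- by move=> k w; rewrite -[_ *: 1]/(k * 1) mulr1.
exists K, r, psi; split=> //; first by rewrite dimvf.
move=> i; exists (psi (vpick (P i))).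
  rewrite -(linear0 psi) (inj_eq (bij_inj psi_bij)) vpick0 -dimv_eq0 dimP //.
have PE : P i = <[vpick (P i)]>%VS.
  apply/esym/eqP; rewrite eqEdim -memvE memv_pick dim_vline vpick0 -dimv_eq0.
  by rewrite dimP.
move=> v; rewrite {1}PE; apply/vlineP/vlineP => -[a vE]; exists a.
  by rewrite vE psiZ.
by apply: (bij_inj psi_bij); rewrite psiZ.
Qed.

Lemma card_fset_filter (T : choiceType) (A : {fset T}) (p : pred T) :
  #|` [fset x in A | p x]%fset| = #|[set k : A | p (val k)]|.
Proof.
rewrite -(@card_fsub _ A); last by apply/fsubsetP=> x; rewrite !inE => /andP[].
by apply: eq_card => k; rewrite in_fsub !inE fsvalP.
Qed.

Lemma fset_third (T : choiceType) (A : {fset T}) (x y : T) : (2 < #|` A|)%N ->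
  exists z, [/\ z \in A, x != z & y != z].
Proof.
move=> A_gt2; have : (0 < #|` (A `\ x) `\ y|)%fset%N.
  have := cardfsD1 y (A `\ x)%fset; have := cardfsD1 x A.
  by case: (x \in A); case: (y \in (A `\ x)%fset); lia.
rewrite cardfs_gt0 => /fset0Pn[z]; rewrite !inE => /and3P[zy zx zA].
by exists z; rewrite zA eq_sym zx eq_sym zy.
Qed.

Lemma fset_gt1 (T : choiceType) (A : {fset T}) (x y : T) :
  x \in A -> y \in A -> x != y -> (1 < #|` A|)%N.
Proof.
move=> xA yA xy; rewrite (cardfsD1 x) xA (cardfsD1 y) !inE eq_sym xy yA.
by lia.
Qed.

Section Quotient.
Variables (F : fieldType) (V : vectType F) (E : {vspace V}).

Lemma dim_qimg U : (E <= U)%VS -> \dim (qmap E @: U) = (\dim U - \dim E)%N.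
Proof.
move=> EU; rewrite -(limg_ker_dim (qmap E) U).
by rewrite lker_qmap (capv_idPr EU) addKn.
Qed.

Lemma qimg_sub U U' : (E <= U')%VS ->
  (qmap E @: U <= qmap E @: U')%VS = (U <= U')%VS.
Proof.
move=> EU'; apply/idP/idP; last exact: limgS.
move=> UU'; apply/subvP=> v vU.
have /memv_imgP[w wU' vw] := subvP UU' _ (memv_img (qmap E) vU).
rewrite -[v](subrK w) memvD //; apply: (subvP EU').
by rewrite -(lker_qmap E) memv_ker linearB /= vw subrr.
Qed.

Lemma dim_qspace : \dim {:qspace E} = (\dim {:V} - \dim E)%N.
Proof. by rewrite -limg_qmap dim_qimg ?subvf. Qed.

End Quotient.

(** * The weak egg seen in the quotient by [E] *)

Section WeakEgg.
Variables (F : finFieldType) (n m : nat) (V : vectType F).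
Variables (A : {fset {vspace V}}) (E : {vspace V}).
Local Notation q := #|F|.
Hypothesis n_gt0 : (1 <= n)%N.
Hypothesis lt_nm : (n < m)%N.
Hypothesis dimV : \dim {:V} = (2 * n + m)%N.
Hypothesis EA : E \in A.
Hypothesis eggA : weak_egg n m A.

Let q_gt1 : (1 < q)%N := finNzRing_gt1 F.
Let cardA : #|` A| = (q ^ m + 1)%N. Proof. by case: eggA. Qed.
Let dimA X : X \in A -> \dim X = n. Proof. by case: eggA => _ + _; apply. Qed.
Let dim3A X Y Z : X \in A -> Y \in A -> Z \in A ->
  X != Y -> X != Z -> Y != Z -> \dim (X + Y + Z) = (3 * n)%N.
Proof. by case: eggA => _ _; apply. Qed.

(** A third element [Z] exists because [q ^ m + 1 > 2]; three [n]-spaces spanning dimension [3 * n]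
    are pairwise disjoint. *)
Lemma weak_egg_disjoint X Y : X \in A -> Y \in A -> X != Y -> (X :&: Y = 0)%VS.
Proof.
move=> XA YA XY.
have A_gt2 : (2 < #|` A|)%N.
  by rewrite cardA addn1 ltnS -(exp1n m) ltn_exp2r // (ltn_trans _ lt_nm).
have [Z [ZA XZ YZ]] := fset_third X Y A_gt2.
apply/eqP; rewrite -dimv_eq0.
have := dimv_sum_cap (X + Y) Z; rewrite (dim3A XA YA ZA XY XZ YZ) (dimA ZA).
by have := dimv_sum_cap X Y; rewrite (dimA XA) (dimA YA); lia.
Qed.

Local Notation I := (A `\ E)%fset.
Definition quo (X : {vspace V}) : {vspace (qspace E)} := (qmap E @: (E + X))%VS.
Local Notation P := (fun i : I => quo (val i)).

Let IA (i : I) : val i \in A.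
Proof. by have := fsvalP i; rewrite inE => /andP[]. Qed.

Let IE (i : I) : val i != E.
Proof. by have := fsvalP i; rewrite !inE => /andP[]. Qed.

Let EI (i : I) : E != val i.
Proof. by rewrite eq_sym IE. Qed.

Let val_neq (i j : I) : i != j -> val i != val j.
Proof. by rewrite (inj_eq val_inj). Qed.

Let dimE2 (i : I) : \dim (E + val i) = (n + n)%N.
Proof.
by rewrite (dimv_disjoint_sum (weak_egg_disjoint EA (IA i) (EI i))) !dimA.
Qed.

Lemma dim_quo (i : I) : \dim (quo (val i)) = n.
Proof. by rewrite dim_qimg ?addvSl // dimE2 dimA // addnK. Qed.

Lemma quoD X Y : (quo X + quo Y = qmap E @: (E + X + Y))%VS.
Proof. by rewrite -limgD addvA (addvC E X) -(addvA X) addvv (addvC X). Qed.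

Lemma dimE3 (i j : I) : i != j -> \dim (E + val i + val j) = (3 * n)%N.
Proof. by move=> ij; apply: dim3A (IA i) (IA j) (EI i) (EI j) (val_neq ij). Qed.

Lemma quo_disjoint (i j : I) : i != j -> (quo (val i) :&: quo (val j) = 0)%VS.
Proof.
move=> ij; apply/eqP; rewrite -dimv_eq0.
have := dimv_sum_cap (quo (val i)) (quo (val j)); rewrite !dim_quo quoD.
rewrite dim_qimg -?addvA ?addvSl // addvA dimE3 // dimA //; lia.
Qed.

Lemma dim_quotient : \dim {:qspace E} = (n + m)%N.
Proof. by rewrite dim_qspace dimV dimA //; lia. Qed.

Lemma card_quotient : #|{: I}| = (q ^ m)%N.
Proof.
by have := cardA; rewrite (cardfsD1 E A) EA -cardfE add1n addn1 => -[].
Qed.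

Lemma quo_le (i j k : I) :
  (quo (val k) <= quo (val i) + quo (val j))%VS = (val k <= E + val i + val j)%VS.
Proof. by rewrite quoD qimg_sub -?addvA ?addvSl // subv_add addvSl. Qed.

Lemma card_in_space (S : {vspace V}) : (E <= S)%VS ->
  #|` [fset X in A | (X <= S)%VS]%fset| = (#|[set k : I | (val k <= S)%VS]| + 1)%N.
Proof.
move=> ES; rewrite (cardfsD1 E) !inE EA ES /= addnC; congr (_ + 1)%N.
rewrite -(card_fset_filter I (fun X => (X <= S)%VS)); congr #|` _|%fset.
by apply/fsetP=> X; rewrite !inE andbA.
Qed.

Lemma good_at_line : good_at n A E -> forall i j : I, i != j ->
  #|[set k : I | (quo (val k) <= quo (val i) + quo (val j))%VS]| = (q ^ n)%N.
Proof.
move=> good i j ij; pose S := (E + val i + val j)%VS.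
have ES : (E <= S)%VS by rewrite /S -addvA addvSl.
apply: (@addIn 1); rewrite -(good S) ?dimE3 //.
  rewrite card_in_space //; congr (_ + 1)%N.
  by apply: eq_card => k; rewrite !inE quo_le.
apply: fset_gt1 (val_neq ij); rewrite !inE IA IE /S ?addvSr //=.
by rewrite (subv_trans (addvSr E _)) // addvSl.
Qed.

Lemma in_induced (i : I) : quo (val i) \in induced_family A E.
Proof. by apply/imfsetP; exists (val i); rewrite //= fsvalP. Qed.

Lemma induced_family_ind (R : {vspace qspace E} -> Prop) :
  (forall i : I, R (quo (val i))) -> forall X, X \in induced_family A E -> R X.
Proof.
by move=> RI X /imfsetP[Y /= YI ->]; have := RI [` YI]%fset.
Qed.

Lemma good_induces : good_at n A E -> induces_desarguesian n A E.
Proof.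
move=> good; split.
  split; first by apply: induced_family_ind; apply: dim_quo.
  move=> X Y XI; move: X XI Y.
  apply: induced_family_ind => i; apply: induced_family_ind => j.
  by move=> ij; apply: quo_disjoint; apply: contraNneq ij => ->.
have [K [r [psi [dimK psi_bij PsiP]]]] : exists (K : fieldExtType F) (r : nat)
    (psi : {linear qspace E -> 'rV[K]_r | in_alg K \; *:%R}),
  [/\ \dim {:K} = n, bijective psi
    & forall i : I, exists2 u : 'rV[K]_r, u != 0 &
        forall v, (v \in quo (val i)) = (psi v \in <[u]>%VS)].
  (* Points are treated apart: over the field with two elements, the vectors of a 1-space do not sum
     to 0, as the hole argument requires. *)
  have [n1|n_neq1] := eqVneq n 1%N.
    rewrite n1; apply: (@coordinates_dim1 F (qspace E) I P) => i.
    by rewrite dim_quo n1.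
  apply: (desarguesian_coordinates (P := P) (m := m)) => //.
  - by rewrite ltn_neqAle eq_sym n_neq1.
  - exact: dim_quo.
  - exact: quo_disjoint.
  - exact: dim_quotient.
  - exact: card_quotient.
  exact: good_at_line.
exists (fun S : {vspace qspace E} => exists2 u : 'rV[K]_r, u != 0 &
    forall v, (v \in S) = (psi v \in <[u]>%VS)); first by exists K, r, psi.
by apply: induced_family_ind.
Qed.

(** The bound [q ^ n + 1] of [hyperoval_bound] counts [E] itself. *)
Lemma line_size_odd (i j : I) : odd q -> i != j ->
  (#|[set k : I | (val k <= E + val i + val j)%VS]| <= q ^ n)%N.
Proof.
move=> q_odd ij; rewrite -(leq_add2r 1) -card_in_space -?addvA ?addvSl //.
rewrite addvA card_fset_filter.
apply: (@hyperoval_bound F V A (fun k : A => val k) n (E + val i + val j)%VS) => //.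
- by move=> k; apply: dimA (fsvalP k).
- move=> k l; rewrite -(inj_eq val_inj).
  exact: weak_egg_disjoint (fsvalP _) (fsvalP _).
- move=> k l p; rewrite -!(inj_eq val_inj) => kl kp lp.
  exact: (dim3A (fsvalP k) (fsvalP l) (fsvalP p) kl kp lp).
- exact: dimE3.
by move=> k; rewrite inE.
Qed.

(** The image of [T] has dimension [m] in a quotient of dimension [n + m], so it meets every line in
    dimension at least [n], while it is skew from every [P k]. *)
Lemma line_size_egg (i j : I) : egg n m A -> i != j ->
  (#|[set k : I | (val k <= E + val i + val j)%VS]| <= q ^ n)%N.
Proof.
move=> [_ /(_ E EA)[T [dimT ET skewT]]] ij.
have -> : [set k : I | (val k <= E + val i + val j)%VS] =
    [set k : I | (P k <= P i + P j)%VS].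
  by apply/setP=> k; rewrite !inE quo_le.
have dimL : \dim (P i + P j) = (n + n)%N := dim_line dim_quo quo_disjoint ij.
apply: (@spread_size_skew F _ _ P n n_gt0 dim_quo quo_disjoint _
  (qmap E @: T)%VS _ dimL).
- have := dimv_sum_cap (P i + P j) (qmap E @: T).
  rewrite dimL dim_qimg // dimT dimA //.
  have := dimvS (subvf ((P i + P j) + qmap E @: T)); rewrite dim_quotient; lia.
- move=> k; apply/eqP; rewrite -subv0; apply/subvP=> v; rewrite memv_cap memv0.
  case/andP=> /memv_imgP[a /memv_addP[e eE [x xk ->]] ->] /memv_imgP[b bT abT].
  have xT : x \in T.
    have : e + x - b \in E by rewrite -(lker_qmap E) memv_ker linearB /= abT subrr.
    move/(subvP ET) => ebT; have eT := subvP ET _ eE.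
    by rewrite -(addKr e x) memvD ?memvN // -(subrK b (e + x)) memvD.
  have : x \in (T :&: val k)%VS by rewrite memv_cap xT.
  rewrite skewT ?IA ?IE // memv0 => /eqP->; rewrite addr0.
  by rewrite -memv_ker lker_qmap.
by move=> k; rewrite inE.
Qed.

End WeakEgg.

(** * Lines of a Desarguesian spread, and the conclusion *)

Lemma desarguesian_line_meet (F : finFieldType) (W : vectType F) (I : finType)
    (P : I -> {vspace W}) (K : fieldExtType F) (r : nat)
    (psi : {linear W -> 'rV[K]_r | in_alg K \; *:%R}) :
  bijective psi ->
  (forall i, exists2 u : 'rV[K]_r, u != 0 &
     forall v, (v \in P i) = (psi v \in <[u]>%VS)) ->
  forall i j k v, v \in (P i + P j)%VS -> v \in (P i + P k)%VS -> v \notin P i ->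
    (P k <= P i + P j)%VS.
Proof.
move=> [phi psiK phiK] Ppsi i j k v /memv_addP[x xi [y yj vE]].
case/memv_addP=> [x' xi' [z zk vE']] vi; apply/subvP=> t tk.
have PZ l a b : b \in P l -> phi (a *: psi b) \in P l.
  by have [u _ uP] := Ppsi l; rewrite !uP phiK => bu; apply: memvZ.
have nzz : z != 0 by apply: contraNneq vi => z0; rewrite vE' z0 addr0.
have [a tE] : exists a, psi t = a *: psi z.
  have [u nzu uP] := Ppsi k; move: tk zk; rewrite !uP.
  case/vlineP=> a -> /vlineP[b zE]; exists (a / b); rewrite zE scalerA divfK //.
  apply: contraNneq nzz => b0; rewrite -(inj_eq (can_inj psiK)) zE b0 scale0r.
  by rewrite linear0.
(* Any [t] in [P k] is a [K]-multiple of [z], and [P i + P j] contains [z] and is closed under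
   [K]. *)
have zE : z = (x - x') + y by rewrite -[z](addKr x') -vE' vE addrA [- x' + x]addrC.
rewrite -[t]psiK tE zE linearD scalerDr.
have -> : phi (a *: psi (x - x') + a *: psi y)
          = phi (a *: psi (x - x')) + phi (a *: psi y).
  by apply: (can_inj psiK); rewrite linearD /= !phiK.
by apply: memv_add; apply: PZ; rewrite ?memvB.
Qed.

Theorem theorem2p2 (F : finFieldType) (n m : nat) (V : vectType F)
    (A : {fset {vspace V}}) (E : {vspace V}) :
  (1 <= n)%N -> (n < m)%N -> \dim {:V} = (2 * n + m)%N -> E \in A ->
  (weak_egg n m A -> good_at n A E -> induces_desarguesian n A E) /\
  ((if odd #|F| then weak_egg n m A else egg n m A) ->
   induces_desarguesian n A E -> good_at n A E).
Proof.
move=> n_gt0 lt_nm dimV EA; split=> [eggA|eggA'].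
  exact: (good_induces n_gt0 lt_nm dimV EA eggA).
case=> _ [D [K [r [psi [_ psi_bij DP]]]] AD].
have eggA : weak_egg n m A by move: eggA'; case: odd => // -[].
have line_le (i j : (A `\ E)%fset) : i != j ->
    (#|[set k : (A `\ E)%fset | (val k <= E + val i + val j)%VS]| <= #|F| ^ n)%N.
  move: eggA'; case: (boolP (odd #|F|)) => [q_odd _|_ eggA'].
    exact: (line_size_odd n_gt0 lt_nm dimV EA eggA).
  exact: (line_size_egg n_gt0 lt_nm dimV EA eggA).
move=> S dimS ES S2.
(* Two elements of [S] other than [E] span [S] with [E], so [S] becomes a line of the quotient,
   whose size is given by [pencil_line]. *)
have [i [j [ij iS jS]]] : exists i j : (A `\ E)%fset,
    [/\ i != j, (val i <= S)%VS & (val j <= S)%VS].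
  have S2' : (1 < #|[set k : (A `\ E)%fset | (val k <= S)%VS]|)%N.
    rewrite -(card_fset_filter _ (fun X => (X <= S)%VS)) (leq_trans S2) //.
    apply/fsubset_leq_card/fsubsetP=> X; rewrite !inE => /and3P[-> -> ->] //.
  have [i [j [iS jS ij]]] := card_gt1P S2'.
  by exists i, j; rewrite !inE in iS jS; split.
have SE : (E + val i + val j)%VS = S.
  apply/eqP; rewrite eqEdim !subv_add ES iS jS dimS.
  by rewrite (dimE3 EA eggA ij) leqnn.
pose P (k : (A `\ E)%fset) := quo E (val k).
have dimP : forall k, \dim (P k) = n := dim_quo n_gt0 lt_nm dimV EA eggA.
have disjP : forall k l, k != l -> (P k :&: P l = 0)%VS :=
  quo_disjoint n_gt0 lt_nm dimV EA eggA.
have PsiP (k : (A `\ E)%fset) : exists2 u : 'rV[K]_r, u != 0 &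
    forall v, (v \in P k) = (psi v \in <[u]>%VS).
  exact/DP/AD/in_induced.
rewrite (card_in_space EA ES) -SE; congr (_ + 1)%N.
rewrite -(@pencil_line F _ _ P n n_gt0 dimP disjP m i
  (dim_quotient n_gt0 lt_nm dimV EA eggA) (card_quotient EA eggA) _ _ j) 1?eq_sym //.
- by apply: eq_card => k; rewrite !inE quo_le.
- move=> k l v ki li vk vl vi; rewrite eq_sym in ki; rewrite eq_sym in li.
  apply/esym.
  apply: line_eq dimP disjP _ _ _ (dim_line dimP disjP ki) li (addvSl _ _) _.
  exact: desarguesian_line_meet psi_bij PsiP _ _ _ v vk vl vi.
move=> k ki; rewrite eq_sym in ki; apply: leq_trans (line_le i k ki).
by rewrite eq_leq //; apply: eq_card => l; rewrite !inE quo_le.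
Qed.
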